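(* The pseudo-resolvent family $(R^\ast_\lambda)_{\lambda>0}$ is strongly continuous on the closure $\overline{\mathrm{Ker}(B)\cap H^1}$ of $\mathrm{Ker}(B)\cap H^1$ in $H$; i.e. $$\lim_{\lambda\to\infty}\|\lambda R^\ast_\lambda g-g\|=0\qquad\text{for all }g\in\overline{\mathrm{Ker}(B)\cap H^1},$$ where $\|\cdot\|$ is the norm of $H$.
   Context: Setting. $(M,g)$ is a compact oriented $d$-dimensional Riemannian manifold without boundary, $U\in C^1(M)$ is such that $\pi(dx)=e^{-U(x)}\mathrm{vol}(dx)$ is a probability measure, $\langle f,h\rangle=\int_M fh\,d\pi$, and $v\cdot w$ denotes the Riemannian inner product of tangent vectors. $A$ is the Friedrichs extension in $L^2(M,\pi)$ of $f\mapsto\Delta f-\nabla U\cdot\nabla f$ on $C^\infty(M)$ ($\Delta$ has spectrum in $(-\infty,0]$). It is assumed that $A$ has discrete spectrum $0=\lambda_0>-\lambda_1\ge-\lambda_2\ge\dots$ with $\lambda_n\to\infty$ and a complete orthonormal basis of eigenvectors $\phi_0,\phi_1,\dots$ of $L^2(M,\pi)$, $A\phi_n=-\lambda_n\phi_n$, with $\phi_0$ spanning the constants. Sobolev spaces: $H^m=\{\varphi=\sum_{k\ge1}a_k\phi_k:\ \sum_{k\ge1}|a_k|^2\lambda_k^m<\infty\}$ and $H:=H^0$ (the orthogonal complement of the constants in $L^2(M,\pi)$, with the $L^2$ norm). On $H^1$: $\langle f,h\rangle_{H^1}=\int_M\nabla f\cdot\nabla h\,d\pi$. $b$ is a $C^1$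 vector field on $M$ with $\mathrm{div}(e^{-U}b)=0$ and $H^1\subset\mathrm{Dom}(b\cdot\nabla)$. $B:H^1\to H$ is the continuous extension of $f\mapsto b\cdot\nabla f$ from smooth functions; it is antisymmetric. $\mathrm{Ker}(B)\cap H^1=\{\varphi\in H^1:B\varphi=0\}$. $R^\ast_\lambda g:=-P_{1,\lambda}(A-\lambda)^{-1}g$ for $g\in H$, $\lambda>0$, where $P_{1,\lambda}$ is the orthogonal projection of $H^1$ onto $\mathrm{Ker}(B)\cap H^1$ with respect to $\langle\psi,\varphi\rangle_{1,\lambda}=\langle\psi,\varphi\rangle_{H^1}+\lambda\langle\psi,\varphi\rangle$. *)

(* Defs.v *)
From mathcomp Require Import all_boot all_order all_algebra.
From mathcomp Require Import all_classical all_reals all_analysis.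

Set Implicit Arguments.
Unset Strict Implicit.
Unset Printing Implicit Defensive.

Import Order.TTheory GRing.Theory Num.Theory.
Import numFieldNormedType.Exports.

Local Open Scope classical_set_scope.
Local Open Scope ring_scope.

Definition partial (R : realType) (d : nat) (k : 'I_d) (F : 'rV[R]_d -> R)
  : 'rV[R]_d -> R := fun y => 'D_(delta_mx 0 k) F y.

(* [Ck n V F]: F is of class C^n on the set V, meant to be open; the values   *)
(* of F outside V are irrelevant.                                             *)
Fixpoint Ck (R : realType) (d n : nat) (V : set 'rV[R]_d)
    (F : 'rV[R]_d -> R) : Prop :=
  match n with
  | 0%N => forall y, V y -> {for y, continuous F}
  | m.+1 => (forall y, V y -> differentiable F y) /\
            (forall k, Ck m V (partial k F))
  end.

(* A smooth d-manifold without boundary, given by an oriented atlas of charts *)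
(* onto open subsets of R^d, with a smooth metric. Tangent vectors at a point *)
(* of [dom i] are row vectors of coordinates in the chart i; as in            *)
(* [deriveEjacobian], the change of coordinates from i to j acts on them by   *)
(* right multiplication by the Jacobian matrix. The carrier is pointed        *)
(* because measurable types are. [chart_at] only selects, at every point, the *)
(* chart in which coordinate-independent expressions are evaluated.           *)
Record orientedRiemannianManifold (R : realType) (d : nat) := {
  carrier :> ptopologicalType ;
  chart_index : Type ;
  dom : chart_index -> set carrier ;
  chart : chart_index -> carrier -> 'rV[R]_d ;
  cochart : chart_index -> 'rV[R]_d -> carrier ;
  chart_at : carrier -> chart_index ;
  metric : chart_index -> 'rV[R]_d -> 'M[R]_d ;
  transition := fun i j => chart j \o cochart i ;
  overlap := fun i j => chart i @` (dom i `&` dom j) ;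
  manifold_hausdorff : hausdorff_space carrier ;
  dom_open : forall i, open (dom i) ;
  dom_chart_at : forall x, dom (chart_at x) x ;
  chart_open : forall i, open (chart i @` dom i) ;
  chartK : forall i x, dom i x -> cochart i (chart i x) = x ;
  chart_continuous : forall i x, dom i x -> {for x, continuous (chart i)} ;
  cochart_continuous : forall i y, (chart i @` dom i) y ->
    {for y, continuous (cochart i)} ;
  transition_smooth : forall i j k n,
    Ck n (overlap i j) (fun y => transition i j y 0 k) ;
  transition_oriented : forall i j y, overlap i j y ->
    0 < \det (jacobian (transition i j) y) ;
  metric_smooth : forall i k l n,
    Ck n (chart i @` dom i) (fun y => metric i y k l) ;
  metric_sym : forall i y, (chart i @` dom i) y ->
    (metric i y)^T = metric i y ;
  metric_pos : forall i y (v : 'rV[R]_d), (chart i @` dom i) y -> v != 0 ->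
    0 < (v *m metric i y *m v^T) 0 0 ;
  metric_change : forall i j y, overlap i j y ->
    metric i y = jacobian (transition i j) y *m metric j (transition i j y)
                 *m (jacobian (transition i j) y)^T
}.

Notation borel T := (g_sigma_algebraType (@open T)).

Section RiemannianCalculus.
Context (R : realType) (d : nat) (M : orientedRiemannianManifold R d).
Implicit Types (f h U : M -> R).

Definition CkM (n : nat) (f : M -> R) : Prop :=
  forall i, Ck n (chart i @` dom i) (f \o cochart (o := M) i).

Definition smooth (f : M -> R) : Prop := forall n, CkM n f.

(* A vector field is represented by its components in all charts.             *)
Definition field_components := chart_index M -> 'rV[R]_d -> 'rV[R]_d.

Definition C1_vector_field (X : field_components) : Prop :=
  (forall i k, Ck 1 (chart i @` dom i) (fun y => X i y 0 k)) /\
  (forall i j y, overlap (o := M) i j y ->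
     X j (transition i j y) = X i y *m jacobian (transition (o := M) i j) y).

Definition grad (f : M -> R) : field_components := fun i y =>
  (\row_k partial k (f \o cochart i) y) *m invmx (metric i y).

Definition inner (X Y : field_components) (x : M) : R :=
  let i := chart_at x in let y := chart i x in
  (X i y *m metric i y *m (Y i y)^T) 0 0.

Definition divergence (X : field_components) (x : M) : R :=
  let i := chart_at x in let y := chart i x in
  (Num.sqrt (\det (metric i y)))^-1 *
  \sum_(k < d) partial k
    (fun z => Num.sqrt (\det (metric i z)) * X i z 0 k) y.

Definition laplacian (f : M -> R) : M -> R := divergence (grad f).

(* Lebesgue measure on R^d, determined by its values on half-open boxes.      *)
Definition is_lebesgue
    (leb : {measure set (borel 'rV[R]_d) -> \bar R}) : Prop :=
  forall a b : 'rV[R]_d, (forall k, a 0 k <= b 0 k) ->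
    leb [set y : 'rV[R]_d | forall k, a 0 k < y 0 k <= b 0 k] =
    (\prod_(k < d) (b 0 k - a 0 k))%:E.

Definition is_riemannian_volume
    (vol : {measure set (borel M) -> \bar R}) : Prop :=
  exists2 leb : {measure set (borel 'rV[R]_d) -> \bar R}, is_lebesgue leb &
  forall (i : chart_index M) (A : set (borel M)),
    measurable A -> A `<=` dom i ->
    vol A = (\int[leb]_(y in chart i @` A)
               (Num.sqrt (\det (metric i y)))%:E)%E.

Definition generator (U f : M -> R) : M -> R :=
  fun x => laplacian f x - inner (grad U) (grad f) x.

End RiemannianCalculus.

(* Elements of L^2 are represented by square-integrable functions, identified *)
(* when they are equal almost everywhere; accordingly, operators are given by *)
(* their graphs or by a choice of representatives.                            *)
Section L2.
Context (R : realType) (d : nat) (M : orientedRiemannianManifold R d).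
Context (P : probability (borel M) R).
Implicit Types (f g h w psi : M -> R) (u : nat -> M -> R).

Definition L2 (f : M -> R) : Prop := f \in Lfun P 2%:E.

Definition L2norm (f : M -> R) : \bar R := 'N[P]_2%:E [EFin \o f].

Definition ip (f h : M -> R) : R := \int[P]_(x in setT) (f x * h x).

Definition L2cvg (u : nat -> M -> R) (f : M -> R) : Prop :=
  L2norm (u n \- f) @[n --> \oo] --> 0%E.

(* u approximates f, from within D, with respect to the norm of the closure   *)
(* of the quadratic form q.                                                   *)
Definition form_approx (D : set (M -> R)) (q : (M -> R) -> R)
    (f : M -> R) (u : nat -> M -> R) : Prop :=
  [/\ forall n, D (u n),
      L2cvg u f &
      forall eps, 0 < eps -> exists N, forall m n, (N <= m)%N -> (N <= n)%N ->
        q (u m \- u n) < eps].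

(* Graph of the Friedrichs extension of a symmetric nonpositive operator L    *)
(* with domain D: the restriction of the adjoint of L to the domain of the    *)
(* closure of the form <- L f, f>.                                            *)
Definition friedrichs (D : set (M -> R)) (L : (M -> R) -> M -> R)
    (f w : M -> R) : Prop :=
  [/\ L2 f, L2 w,
      exists u, form_approx D (fun h => - ip (L h) h) f u &
      forall h, D h -> ip f (L h) = ip w h].

Definition A_graph (U : M -> R) : (M -> R) -> (M -> R) -> Prop :=
  friedrichs (@smooth R d M) (generator U).

(* The equation (A - lam) f = g, solved with A given by its graph.            *)
Definition A_resolvent (U : M -> R) (lam : R) (g : M -> R) : M -> R :=
  xget (cst 0) [set f | exists2 w, A_graph U f w &
                        {ae P, forall x, w x - lam * f x = g x}].

Definition orthonormal_basis (phi : nat -> M -> R) : Prop :=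
  [/\ forall n, L2 (phi n),
      forall m n, ip (phi m) (phi n) = (m == n)%:R &
      forall f, L2 f ->
        L2cvg (fun n x => \sum_(0 <= k < n) ip f (phi k) * phi k x) f].

(* [ev k] stands for lambda_k, the opposite of the k-th eigenvalue of A.      *)
Definition spectral_basis (U : M -> R) (ev : nat -> R) (phi : nat -> M -> R)
    : Prop :=
  [/\ orthonormal_basis phi,
      forall n, A_graph U (phi n) (fun x => - ev n * phi n x),
      exists c, {ae P, forall x, phi 0%N x = c} &
      [/\ ev 0%N = 0, 0 < ev 1%N,
          forall m n, (m <= n)%N -> ev m <= ev n &
          ev n @[n --> \oo] --> +oo]].

Section Sobolev.
Context (ev : nat -> R) (phi : nat -> M -> R).

Definition Sobolev (m : nat) (f : M -> R) : Prop :=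
  L2 f /\ exists a : nat -> R,
    L2cvg (fun n x => \sum_(1 <= k < n) a k * phi k x) f /\
    (\sum_(1 <= k <oo) (`|a k| ^+ 2 * ev k ^+ m)%:E < +oo)%E.

Definition dirichlet (f h : M -> R) : R :=
  \int[P]_(x in setT) inner (grad f) (grad h) x.

Definition H1_approx (f : M -> R) (u : nat -> M -> R) : Prop :=
  form_approx (@smooth R d M) (fun h => dirichlet h h) f u.

(* The gradient of an element of H^1 is the L^2 limit of the gradients of     *)
(* smooth functions approximating it, so that the integral of                 *)
(* grad f . grad h is the limit of the corresponding integrals.               *)
Definition H1_ip (f h : M -> R) : R :=
  xget 0 [set c | exists u v, [/\ H1_approx f u, H1_approx h v &
                    dirichlet (u n) (v n) @[n --> \oo] --> c]].

Section Drift.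
Context (b : field_components M).

Definition drift (f : M -> R) : M -> R := inner b (grad f).

(* Domain of the closure in L^2 of f |-> b . grad f on smooth functions.      *)
Definition drift_dom (f : M -> R) : Prop :=
  exists2 w, L2 w &
  exists u, [/\ forall n, smooth (u n), L2cvg u f &
                L2cvg (fun n => drift (u n)) w].

(* B is the extension by continuity to H^1 of the operator [drift] on smooth  *)
(* functions; [B_graph f w] means that B f = w almost everywhere.             *)
Definition B_graph (f w : M -> R) : Prop :=
  [/\ Sobolev 1 f, Sobolev 0 w &
      exists2 u, H1_approx f u & L2cvg (fun n => drift (u n)) w].

Definition KerB (f : M -> R) : Prop := B_graph f (cst 0).

Definition KerB_closure (g : M -> R) : Prop :=
  Sobolev 0 g /\
  forall eps : R, 0 < eps ->
    exists2 f, KerB f & (L2norm (f \- g)%R < eps%:E)%E.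

Definition ip1 (lam : R) (f h : M -> R) : R := H1_ip f h + lam * ip f h.

(* Orthogonal projection of H^1 onto Ker(B) for the inner product [ip1 lam].  *)
Definition KerB_proj (lam : R) (psi : M -> R) : M -> R :=
  xget (cst 0) [set p | KerB p /\
                        forall eta, KerB eta -> ip1 lam (psi \- p) eta = 0].

Definition Rstar (U : M -> R) (lam : R) (g : M -> R) : M -> R :=
  \- KerB_proj lam (A_resolvent U lam g).

End Drift.
End Sobolev.
End L2.

(* Main.v *)
(* Write a for the form <grad f, grad h> + lam <f, h>.  The resolvent          *)
(* r = R*_lam g lies in Ker(B) and satisfies a(r, eta) = <g, eta> for eta in   *)
(* Ker(B).  For f in Ker(B), testing with e = lam r - f and completing squares *)
(* gives |e|^2 <= |g - f|^2 + |grad f|^2 / (2 lam), which is small once f is   *)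
(* close to g and lam is large.                                                *)
(* No integration by parts on M is needed: the eigenbasis makes                *)
(* L = Laplacian - grad U . grad symmetric and annihilated by the mean, and    *)
(* L(fh) = f Lh + h Lf + 2 <grad f, grad h> then yields Green's identity.      *)
(* What remains of the geometry is that L f and inner products of gradients do *)
(* not depend on the chart, so that they are continuous, hence bounded and     *)
(* measurable.  The abstract operators A, P_{1,lam} exist because the form is  *)
(* closable and L^2 is complete.                                               *)
Require Import Defs.
From mathcomp Require Import all_boot all_order all_algebra.
From mathcomp Require Import all_classical all_reals all_analysis.
From mathcomp Require Import perm measurable_realfun zify ring lra.
Import Order.TTheory GRing.Theory Num.Theory.
Import numFieldNormedType.Exports.
Local Open Scope classical_set_scope.
Local Open Scope ring_scope.

Set Implicit Arguments.
Unset Strict Implicit.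
Unset Printing Implicit Defensive.

(** Projecting the resolvent onto Ker(B) preserves its variational equation against test vectors of
    Ker(B). Hence r = [Rstar] g acts as the resolvent of a nonnegative form restricted to Ker(B),
    and the usual energy argument applies: [resolvent_estimate] bounds lam r - f for every f in
    Ker(B) by the distance from g to f plus an energy term of order 1/lam. [Rstar_cvg] fixes f close
    to g first and then lets lam grow.

    The functional analysis is abstract. A form E(u,v) = - <L u, v> on a core S is closable
    ([closable]), so its extension [form_ext] is well defined. The kernel of a closed operator is
    complete for the shifted form ([closed_core_complete]), and [riesz] then yields both the
    resolvent ([form_resolvent]) and the projection ([closed_core_projection]); the choices made by
    [xget] in the definitions are therefore genuine. Completeness of the ambient space is
    [l2_complete].

    The manifold enters through two facts. Smooth functions, L f and drifts are continuous, by chart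
    independence ([grad_field], [divergenceE]), hence square integrable by compactness. The identity
    E(u,v) = - <L u, v> is [green], obtained from [generator_sym], [ip1_generator] and
    [generator_prod]. The lemmas [H1_ipE], [A_graphP] and [KerBP] translate the concrete definitions
    into the abstract ones. *)

(** * Positive semidefinite forms on a subspace, and convergence for their seminorms *)

Section PsdForm.
Context (R : realType) (V : lmodType R).
Implicit Types (K : set V) (q : V -> V -> R).

Definition linear_subspace K := K 0 /\ forall a x y, K x -> K y -> K (a *: x + y).

(** The laws are required on [K] only, because integrals and form extensions are total functions
    that are bilinear just on their domain. Definiteness is not asked for: elements of L^2 are
    functions, not classes. *)
Record psd_form K q : Prop := PsdForm {
  psd_subspace : linear_subspace K ;
  psdC : forall x y, K x -> K y -> q x y = q y x ;
  psd_linear : forall a x y z, K x -> K y -> K z ->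
    q (a *: x + y) z = a * q x z + q y z ;
  psd_ge0 : forall x, K x -> 0 <= q x x }.

Lemma linear_subspaceD K x y : linear_subspace K -> K x -> K y -> K (x + y).
Proof. by case=> _ H Kx Ky; rewrite -[x]scale1r; exact: H. Qed.

Lemma linear_subspaceZ K a x : linear_subspace K -> K x -> K (a *: x).
Proof. by case=> H0 H Kx; rewrite -[_ *: _]addr0; exact: H. Qed.

Lemma linear_subspaceN K x : linear_subspace K -> K x -> K (- x).
Proof. by move=> sK Kx; rewrite -scaleN1r; exact: linear_subspaceZ. Qed.

Lemma linear_subspaceB K x y : linear_subspace K -> K x -> K y -> K (x - y).
Proof. by move=> sK Kx Ky; apply: linear_subspaceD => //; exact: linear_subspaceN. Qed.

Section Theory.
Context K q (Hq : psd_form K q).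
Let sK := psd_subspace Hq.

Lemma psdDl x y z : K x -> K y -> K z -> q (x + y) z = q x z + q y z.
Proof. by move=> *; rewrite -[x in LHS]scale1r (psd_linear Hq) ?mul1r. Qed.

Lemma psd0l z : K z -> q 0 z = 0.
Proof.
case: sK => K0 _ Kz; apply: (addrI (q 0 z)); rewrite -psdDl// addr0.
by rewrite addr0.
Qed.

Lemma psdZl a x z : K x -> K z -> q (a *: x) z = a * q x z.
Proof.
case: sK => K0 _ Kx Kz; rewrite -[_ *: _ in LHS]addr0.
by rewrite (psd_linear Hq)// psd0l// addr0.
Qed.

Lemma psdNl x z : K x -> K z -> q (- x) z = - q x z.
Proof. by move=> *; rewrite -scaleN1r psdZl// mulN1r. Qed.

Lemma psdBl x y z : K x -> K y -> K z -> q (x - y) z = q x z - q y z.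
Proof. by move=> *; rewrite psdDl ?psdNl//; exact: linear_subspaceN. Qed.

Lemma psdDr x y z : K x -> K y -> K z -> q z (x + y) = q z x + q z y.
Proof.
move=> Kx Ky Kz; rewrite (psdC Hq) ?psdDl//; last exact: linear_subspaceD.
by rewrite (psdC Hq Kx) ?(psdC Hq Ky).
Qed.

Lemma psdZr a x z : K x -> K z -> q z (a *: x) = a * q z x.
Proof.
move=> Kx Kz; rewrite (psdC Hq) ?psdZl//; last exact: linear_subspaceZ.
by rewrite (psdC Hq Kx).
Qed.

Lemma psdNr x z : K x -> K z -> q z (- x) = - q z x.
Proof. by move=> *; rewrite -scaleN1r psdZr// mulN1r. Qed.

Lemma psdBr x y z : K x -> K y -> K z -> q z (x - y) = q z x - q z y.
Proof. by move=> *; rewrite psdDr ?psdNr//; exact: linear_subspaceN. Qed.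

Lemma psdB_sqr x y : K x -> K y -> q (x - y) (x - y) = q x x - 2 * q x y + q y y.
Proof.
move=> Kx Ky; rewrite psdBl ?psdBr//; last exact: linear_subspaceB.
by rewrite (psdC Hq Ky Kx); ring.
Qed.

Lemma psdD_sqr x y : K x -> K y -> q (x + y) (x + y) = q x x + 2 * q x y + q y y.
Proof.
move=> Kx Ky; rewrite psdDl ?psdDr//; last exact: linear_subspaceD.
by rewrite (psdC Hq Ky Kx); ring.
Qed.

(* A quadratic polynomial in [t] that is bounded below controls its linear    *)
(* coefficient; [e = 0] is the Cauchy-Schwarz inequality.                     *)
Lemma quadratic_ge (a c e : R) : 0 <= a -> 0 <= e ->
  (forall t, - e <= 2 * t * c + t ^+ 2 * a) -> c ^+ 2 <= e * a.
Proof.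
move=> a0 e0 H; have [az|ane0] := eqVneq a 0.
  rewrite az mulr0; have [->|cn0] := eqVneq c 0; first by rewrite expr0n.
  (* Without a quadratic term, this t would give the polynomial the value -2(e + 1), which is below
     -e. *)
  have := H (- (e + 1) / c); rewrite az mulr0 addr0 => L.
  have E : 2 * (- (e + 1) / c) * c = - 2 * (e + 1) by field.
  by exfalso; rewrite E in L; lra.
have agt : 0 < a by rewrite lt_def ane0.
have := H (- c / a).
have -> : 2 * (- c / a) * c + (- c / a) ^+ 2 * a = - (c ^+ 2 / a) by field.
by rewrite lerN2 ler_pdivrMr.
Qed.

Lemma psd_CS x y : K x -> K y -> (q x y) ^+ 2 <= q x x * q y y.
Proof.
move=> Kx Ky; apply: quadratic_ge; [exact: (psd_ge0 Hq)|exact: (psd_ge0 Hq)|move=> t].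
have Kt : K (t *: y) by exact: linear_subspaceZ.
have := psd_ge0 Hq (linear_subspaceD sK Kx Kt).
rewrite psdD_sqr// psdZr// psdZl// psdZr//; lra.
Qed.

Definition psd_norm x := Num.sqrt (q x x).

Lemma psd_norm_ge0 x : 0 <= psd_norm x. Proof. exact: sqrtr_ge0. Qed.

Lemma psd_normE x : K x -> psd_norm x ^+ 2 = q x x.
Proof. by move=> Kx; rewrite sqr_sqrtr// (psd_ge0 Hq). Qed.

Lemma psd_CS_norm x y : K x -> K y -> `|q x y| <= psd_norm x * psd_norm y.
Proof.
move=> Kx Ky; rewrite -(@ler_pXn2r _ 2)// ?nnegrE ?mulr_ge0 ?psd_norm_ge0//.
by rewrite exprMn !psd_normE// real_normK ?num_real// psd_CS.
Qed.

Lemma psd_normD x y : K x -> K y -> psd_norm (x + y) <= psd_norm x + psd_norm y.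
Proof.
move=> Kx Ky; rewrite -(@ler_pXn2r _ 2)// ?nnegrE ?addr_ge0 ?psd_norm_ge0//.
rewrite psd_normE; last exact: linear_subspaceD.
rewrite psdD_sqr// sqrrD !psd_normE//.
have := psd_CS_norm Kx Ky; have := ler_norm (q x y); lra.
Qed.

Lemma psd_normZ a x : K x -> psd_norm (a *: x) = `|a| * psd_norm x.
Proof.
move=> Kx; rewrite /psd_norm psdZl// ?psdZr//; last exact: linear_subspaceZ.
by rewrite mulrA -expr2 sqrtrM ?sqr_ge0// sqrtr_sqr.
Qed.

Lemma psd_normN x : K x -> psd_norm (- x) = psd_norm x.
Proof. by move=> Kx; rewrite -scaleN1r psd_normZ// normrN1 mul1r. Qed.

Lemma psd_normBC x y : K x -> K y -> psd_norm (x - y) = psd_norm (y - x).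
Proof. by move=> Kx Ky; rewrite -opprB psd_normN//; exact: linear_subspaceB. Qed.

Lemma psd_norm_sub x y z : K x -> K y -> K z ->
  psd_norm (x - z) <= psd_norm (x - y) + psd_norm (y - z).
Proof.
move=> Kx Ky Kz; rewrite -(subrKA y x) ?psd_normD//; exact: linear_subspaceB.
Qed.

End Theory.

Definition cauchy_for q (u : nat -> V) := forall eps, 0 < eps ->
  exists N, forall m n, (N <= m)%N -> (N <= n)%N -> q (u m - u n) (u m - u n) < eps.

Definition cvg_for q (u : nat -> V) f := q (u n - f) (u n - f) @[n --> \oo] --> 0.

Definition complete_for K q := forall u, (forall n, K (u n)) -> cauchy_for q u ->
  exists2 f, K f & cvg_for q u f.

Section Sequences.
Context K q (Hq : psd_form K q).
Let sK := psd_subspace Hq.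
Implicit Types (u v : nat -> V).

Lemma cvg_forP u f : (forall n, K (u n)) -> K f ->
  cvg_for q u f <-> psd_norm q (u n - f) @[n --> \oo] --> 0.
Proof.
move=> Ku Kf; split => [H|H].
  rewrite -(@sqrtr0 R); apply: continuous_cvg => //; exact: sqrt_continuous.
have E : (fun n => q (u n - f) (u n - f)) = (fun n => psd_norm q (u n - f) ^+ 2).
  by apply/funext => n; rewrite (psd_normE Hq)//; exact: linear_subspaceB.
rewrite /cvg_for E.
rewrite -[X in _ --> X](mulr0 (0 : R)).
by under eq_fun do rewrite expr2; exact: cvgM.
Qed.

Lemma cauchy_forP u : (forall n, K (u n)) -> cauchy_for q u <->
  forall eps, 0 < eps -> exists N, forall m n, (N <= m)%N -> (N <= n)%N ->
    psd_norm q (u m - u n) < eps.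
Proof.
move=> Ku; split => H eps e0.
  have [N HN] := H (eps ^+ 2) (exprn_gt0 _ e0); exists N => m n Nm Nn.
  rewrite -(@ltr_pXn2r _ 2)// ?nnegrE ?psd_norm_ge0 ?(ltW e0)//.
  by rewrite (psd_normE Hq) ?HN//; exact: linear_subspaceB.
have se0 : 0 < Num.sqrt eps by rewrite sqrtr_gt0.
have [N HN] := H _ se0; exists N => m n Nm Nn.
by have := HN _ _ Nm Nn; rewrite /psd_norm ltr_sqrt.
Qed.

Lemma cvg_for_cst f : cvg_for q (fun=> f) f.
Proof. by rewrite /cvg_for subrr (psd0l Hq sK.1); exact: cvg_cst. Qed.

Lemma cvg_for_linear u v f g a : (forall n, K (u n)) -> (forall n, K (v n)) ->
  K f -> K g -> cvg_for q u f -> cvg_for q v g ->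
  cvg_for q (fun n => a *: u n + v n) (a *: f + g).
Proof.
move=> Ku Kv Kf Kg; have KD := sK.2.
move=> /cvg_forP-/(_ Ku Kf) uf /cvg_forP-/(_ Kv Kg) vg.
apply/cvg_forP => [n||]; [exact: KD|exact: KD|].
have H : `|a| * psd_norm q (u n - f) + psd_norm q (v n - g) @[n --> \oo] --> 0.
  rewrite -[0]addr0 -{1}(mulr0 `|a|); apply: cvgD => //; apply: cvgM => //.
  exact: cvg_cst.
apply: (squeeze_cvgr _ (cvg_cst 0) H); near=> n; rewrite psd_norm_ge0/=.
have -> : a *: u n + v n - (a *: f + g) = a *: (u n - f) + (v n - g).
  by rewrite scalerBr opprD addrACA.
have Kuf : K (u n - f) by exact: linear_subspaceB.
rewrite -(psd_normZ Hq) ?(psd_normD Hq)//; first exact: linear_subspaceZ.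
exact: linear_subspaceB.
Unshelve. all: by end_near. Qed.

Lemma cauchy_for_linear u v a : (forall n, K (u n)) -> (forall n, K (v n)) ->
  cauchy_for q u -> cauchy_for q v -> cauchy_for q (fun n => a *: u n + v n).
Proof.
move=> Ku Kv; have KD := sK.2.
move=> /cauchy_forP-/(_ Ku) uf /cauchy_forP-/(_ Kv) vg.
apply/cauchy_forP => [n|eps e0]; first exact: KD.
have a0 : 0 < `|a| + 1 by rewrite ltr_wpDl.
have e1 : 0 < eps / 2 / (`|a| + 1) by rewrite !divr_gt0.
have e2 : 0 < eps / 2 by rewrite divr_gt0.
have [N1 H1] := uf _ e1; have [N2 H2] := vg _ e2.
exists (maxn N1 N2) => m n; rewrite !geq_max => /andP[m1 m2] /andP[n1 n2].
have -> : a *: u m + v m - (a *: u n + v n) = a *: (u m - u n) + (v m - v n).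
  by rewrite scalerBr opprD addrACA.
have Kuf : K (u m - u n) by exact: linear_subspaceB.
apply: le_lt_trans (psd_normD Hq _ _) _; [exact: linear_subspaceZ|exact: linear_subspaceB|].
rewrite (psd_normZ Hq)//; have h2 := H2 _ _ m2 n2; have := H1 _ _ m1 n1.
rewrite ltr_pdivlMr// mulrDr mulr1 [psd_norm _ _ * _]mulrC.
have := psd_norm_ge0 q (u m - u n); move: h2; lra.
Qed.

Lemma cvg_for_ip u v f g : (forall n, K (u n)) -> (forall n, K (v n)) ->
  K f -> K g -> cvg_for q u f -> cvg_for q v g ->
  q (u n) (v n) @[n --> \oo] --> q f g.
Proof.
move=> Ku Kv Kf Kg /cvg_forP-/(_ Ku Kf) uf /cvg_forP-/(_ Kv Kg) vg.
apply/subr_cvg0/norm_cvg0P.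
have H : psd_norm q (u n - f) * psd_norm q (v n - g)
   + psd_norm q (u n - f) * psd_norm q g + psd_norm q f * psd_norm q (v n - g)
   @[n --> \oo] --> 0 * 0 + 0 * psd_norm q g + psd_norm q f * 0.
  by apply: cvgD; [apply: cvgD|]; apply: cvgM => //; exact: cvg_cst.
rewrite !(mul0r, mulr0, addr0) in H.
apply: (squeeze_cvgr _ (cvg_cst 0) H); near=> n; rewrite normr_ge0/=.
have K1 : K (u n - f) by exact: linear_subspaceB.
have K2 : K (v n - g) by exact: linear_subspaceB.
have -> : q (u n) (v n) - q f g = q (u n - f) (v n - g) + q (u n - f) g + q f (v n - g).
  by rewrite !(psdBr Hq)// !(psdBl Hq)//; ring.
apply: le_trans (ler_normD _ _) _; apply: lerD; last exact: (psd_CS_norm Hq).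
by apply: le_trans (ler_normD _ _) _; apply: lerD; exact: (psd_CS_norm Hq).
Unshelve. all: by end_near. Qed.

Lemma cauchy_for_bounded u : (forall n, K (u n)) -> cauchy_for q u ->
  exists2 C, 0 <= C & forall n, psd_norm q (u n) <= C.
Proof.
move=> Ku /cauchy_forP-/(_ Ku)/(_ 1 ltr01)[N HN].
exists (\sum_(k < N.+1) psd_norm q (u k) + 1).
  by rewrite addr_ge0// sumr_ge0// => *; exact: psd_norm_ge0.
move=> n; have [nN|Nn] := ltnP n N.+1.
  rewrite (bigD1 (Ordinal nN))//= -addrA lerDl addr_ge0// sumr_ge0// => *.
  exact: psd_norm_ge0.
have h1 : psd_norm q (u n) <= psd_norm q (u n - u N) + psd_norm q (u N).
  by rewrite -{1}(subrK (u N) (u n)) (psd_normD Hq)//; exact: linear_subspaceB.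
have := HN n N (ltnW Nn) (leqnn N).
have : psd_norm q (u N) <= \sum_(k < N.+1) psd_norm q (u k).
  by rewrite big_ord_recr/= lerDr sumr_ge0// => *; exact: psd_norm_ge0.
lra.
Qed.

End Sequences.
End PsdForm.

(** * Riesz representation in a complete semidefinite space *)

(** Minimise J(x) = q(x,x) - 2 l(x). An almost minimiser almost satisfies the Euler equation
    q(x,eta) = l(eta), with an error controlled by the seminorm of eta. This makes a minimising
    sequence Cauchy, and its limit satisfies the equation exactly. *)
Lemma riesz (R : realType) (V : lmodType R) (K : set V) (q : V -> V -> R)
    (l : V -> R) (C : R) :
  0 <= C -> psd_form K q -> complete_for K q ->
  (forall a x y, K x -> K y -> l (a *: x + y) = a * l x + l y) ->
  (forall x, K x -> (l x) ^+ 2 <= C * q x x) ->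
  exists2 p, K p & forall eta, K eta -> q p eta = l eta.
Proof.
move=> C0 Hq Kc ll lC; have sK := psd_subspace Hq; have K0 := sK.1.
pose J x := q x x - 2 * l x.
(* Since (2 l x)^2 <= 4 C q(x,x) <= (q(x,x) + C)^2, J is bounded below. *)
have JC x : K x -> - C <= J x.
  move=> Kx; have := lC _ Kx; have := psd_ge0 Hq Kx; rewrite /J => q0 H.
  rewrite leNgt; apply/negP => L.
  have {}L : q x x + C < 2 * l x by lra.
  have : (q x x + C) ^+ 2 < (2 * l x) ^+ 2.
    by rewrite ltr_pXn2r// ?nnegrE; lra.
  by have := sqr_ge0 (q x x - C); nra.
pose m := inf (J @` K).
have hJ : has_inf (J @` K).
  by split; [exists (J 0), 0|exists (- C) => _ [x Kx <-]; exact: JC].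
have mJ x : K x -> m <= J x by move=> Kx; apply: ge_inf; [exact: hJ.2|exists x].
(* Compare J(x) with J(x + t eta) >= m: the difference is a quadratic polynomial in t bounded below
   by -e, so [quadratic_ge] applies. *)
have near_min e x eta : 0 <= e -> K x -> J x <= m + e -> K eta ->
    (q x eta - l eta) ^+ 2 <= e * q eta eta.
  move=> e0 Kx Jx Ke; apply: quadratic_ge => //; first exact: (psd_ge0 Hq).
  move=> t; have Kt : K (t *: eta) by exact: linear_subspaceZ.
  have lt : l (x + t *: eta) = l x + t * l eta.
    by rewrite addrC ll// addrC.
  have := mJ _ (linear_subspaceD sK Kx Kt); rewrite /J lt (psdD_sqr Hq)//.
  rewrite (psdZr Hq)// (psdZr Hq)// (psdZl Hq)//.
  by move: Jx; rewrite /J; lra.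
have [u Hu] : {u : nat -> V & forall n, K (u n) /\ J (u n) <= m + n.+1%:R^-1}.
  apply: (@choice _ _ (fun n x => K x /\ J x <= m + n.+1%:R^-1)) => n.
  have n0 : 0 < n.+1%:R^-1 :> R by [].
  have [_ [x Kx <-] Jx] := inf_adherent n0 hJ.
  by exists x; split=> //; exact: ltW.
have Ku n : K (u n) by case: (Hu n).
have cauchy_u : cauchy_for q u.
  (* With Q = q(u_i - u_j, u_i - u_j) = a - b and a^2, b^2 <= d Q, one gets Q^2 <= 4 d Q = eps Q /
     2, which excludes Q >= eps. *)
  move=> eps e0; pose d := eps / 8; have d0 : 0 < d by rewrite divr_gt0.
  have [N _ HN] := near_infty_natSinv_lt (PosNum d0).
  exists N => i j Ni Nj; have Kz : K (u i - u j) by exact: linear_subspaceB.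
  have Jd k : (N <= k)%N -> J (u k) <= m + d.
    move=> Nk; apply: le_trans (Hu k).2 _; rewrite lerD2l ltW//.
    exact: (HN k Nk).
  have a1 := near_min _ _ _ (ltW d0) (Ku i) (Jd i Ni) Kz.
  have a2 := near_min _ _ _ (ltW d0) (Ku j) (Jd j Nj) Kz.
  have : q (u i - u j) (u i - u j) =
    (q (u i) (u i - u j) - l (u i - u j)) - (q (u j) (u i - u j) - l (u i - u j)).
    by rewrite (psdBl Hq)//; ring.
  move: a1 a2; set a := _ - l _; set b := _ - l _; set Q := q _ _ => a1 a2 E.
  have Q0 : 0 <= Q by exact: (psd_ge0 Hq).
  have : Q ^+ 2 <= 4 * d * Q by have := sqr_ge0 (a + b); rewrite E in a1 a2 *; nra.
  rewrite /d => HQ; have [Qe|] := ltP Q eps; [by []|move=> eQ].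
  by exfalso; nra.
have [p Kp up] := Kc u Ku cauchy_u; exists p => // eta Ke.
have lim1 : q (u n) eta @[n --> \oo] --> q p eta.
  apply: (cvg_for_ip Hq Ku (fun=> Ke) Kp Ke up).
  exact: (cvg_for_cst Hq).
have lim2 : (q (u n) eta - l eta) ^+ 2 @[n --> \oo] --> 0.
  have H : n.+1%:R^-1 * q eta eta @[n --> \oo] --> 0.
    rewrite -(mul0r (q eta eta)); apply: cvgM; last exact: cvg_cst.
    exact: cvg_harmonic.
  apply: (squeeze_cvgr _ (cvg_cst 0) H); near=> n; rewrite sqr_ge0/=.
  by apply: near_min; [|exact: Ku|exact: (Hu n).2|].
have lim3 : (q (u n) eta - l eta) ^+ 2 @[n --> \oo] --> (q p eta - l eta) ^+ 2.
  by under eq_fun do rewrite expr2; rewrite expr2; apply: cvgM;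
    apply: cvgB => //; exact: cvg_cst.
have /eqP : (q p eta - l eta) ^+ 2 = 0 by exact: (norm_cvg_unique lim3 lim2).
by rewrite sqrf_eq0 subr_eq0 => /eqP.
Unshelve. all: by end_near. Qed.

(** * Real limits, and sequences close to a Cauchy or convergent one *)

Lemma real_cauchy_cvg (R : realType) (a : nat -> R) :
  (forall eps, 0 < eps -> exists N, forall n, (N <= n)%N -> `|a n - a N| < eps) ->
  exists c : R, a n @[n --> \oo] --> c.
Proof.
move=> H; have ca : cvgn a.
  apply: cauchy_cvg; apply: cauchy_exP => eps e0.
  have [N HN] := H _ e0; exists (a N); exists N => // n /= Nn.
  by rewrite /ball/= distrC HN.
by exists (limn a).
Qed.

Lemma real_cvgP (R : realType) (a : nat -> R) c : a n @[n --> \oo] --> c <->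
  (forall eps, 0 < eps -> exists N, forall n, (N <= n)%N -> `|a n - c| < eps).
Proof.
split=> [/cvgrPdist_lt H eps /H[N _ HN]|H].
  by exists N => n Nn; rewrite distrC; exact: HN.
apply/cvgrPdist_lt => eps /H[N HN]; exists N => // n /= Nn.
by rewrite distrC HN.
Qed.

Section Close.
Context (R : realType) (V : lmodType R) (K : set V) (q : V -> V -> R).
Context (Hq : psd_form K q).
Let sK := psd_subspace Hq.

Lemma cauchy_for_close u v : (forall n, K (u n)) -> (forall n, K (v n)) ->
  psd_norm q (u n - v n) @[n --> \oo] --> 0 -> cauchy_for q u -> cauchy_for q v.
Proof.
move=> Ku Kv /real_cvgP uv /(cauchy_forP Hq Ku) cu; apply/(cauchy_forP Hq Kv).
move=> eps e0; have e3 : 0 < eps / 3 by rewrite divr_gt0.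
have [N1 H1] := uv _ e3; have [N2 H2] := cu _ e3.
have {}H1 n : (N1 <= n)%N -> psd_norm q (u n - v n) < eps / 3.
  by move=> /H1; rewrite subr0 ger0_norm// psd_norm_ge0.
exists (maxn N1 N2) => m n; rewrite !geq_max => /andP[m1 m2] /andP[n1 n2].
have := psd_norm_sub Hq (Kv m) (Ku m) (Kv n).
have := psd_norm_sub Hq (Ku m) (Ku n) (Kv n).
rewrite (psd_normBC Hq (Kv m) (Ku m)).
have := H1 _ m1; have := H1 _ n1; have := H2 _ _ m2 n2; lra.
Qed.

Lemma cvg_for_close u v f : (forall n, K (u n)) -> (forall n, K (v n)) -> K f ->
  psd_norm q (u n - v n) @[n --> \oo] --> 0 -> cvg_for q u f -> cvg_for q v f.
Proof.
move=> Ku Kv Kf uv /(cvg_forP Hq Ku Kf) uf; apply/(cvg_forP Hq Kv Kf).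
have H : psd_norm q (u n - v n) + psd_norm q (u n - f) @[n --> \oo] --> 0.
  by rewrite -[0]addr0; apply: cvgD.
apply: (squeeze_cvgr _ (cvg_cst 0) H); near=> n; rewrite psd_norm_ge0/=.
by rewrite (psd_normBC Hq (Ku n) (Kv n)); exact: (psd_norm_sub Hq).
Unshelve. all: by end_near. Qed.

Lemma psd_form_sub K' : linear_subspace K' -> K' `<=` K -> psd_form K' q.
Proof.
move=> sK' KK; split; first exact: sK'.
- by move=> x y /KK Kx /KK Ky; exact: (psdC Hq).
- by move=> a x y z /KK Kx /KK Ky /KK Kz; exact: (psd_linear Hq).
- by move=> x /KK Kx; exact: (psd_ge0 Hq).
Qed.

End Close.

(** * Closure of a form represented by an operator on a core *)

Section FormExtension.
Context (R : realType) (V : lmodType R) (X S : set V) (ip E : V -> V -> R).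
Context (L : V -> V) (Hip : psd_form X ip) (Xc : complete_for X ip).
Context (HE : psd_form S E) (SX : S `<=` X) (LX : forall u, S u -> X (L u)).
Context (EL : forall u v, S u -> S v -> E u v = - ip (L u) v).
Let sX := psd_subspace Hip.
Let sS := psd_subspace HE.

Definition core_approx f (u : nat -> V) :=
  [/\ forall n, S (u n), cvg_for ip u f & cauchy_for E u].

(** The shape copies [H1_ip], so that [H1_ipE] only has to match the approximating sequences. That
    the limit exists and does not depend on them is [form_cvg_ex] and [form_cvg_indep]. *)
Definition form_ext f h := xget 0 [set c : R | exists u v,
  [/\ core_approx f u, core_approx h v & E (u n) (v n) @[n --> \oo] --> c]].

Definition form_dom f := X f /\ exists u, core_approx f u.

Lemma approx_linear a f g u v : X f -> X g -> core_approx f u -> core_approx g v ->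
  core_approx (a *: f + g) (fun n => a *: u n + v n).
Proof.
move=> Xf Xg [Su uf cu] [Sv vg cv]; split.
- by move=> n; exact: sS.2.
- by apply: (cvg_for_linear Hip) => // n; exact: SX.
- exact: (cauchy_for_linear HE).
Qed.

Lemma approx_cst u : S u -> core_approx u (fun=> u).
Proof.
move=> Su; split=> //.
  exact: (cvg_for_cst Hip).
by move=> eps e0; exists 0%N => m n _ _; rewrite subrr (psd0l HE sS.1).
Qed.

Lemma approxB f g u v : X f -> X g -> core_approx f u -> core_approx g v ->
  core_approx (f - g) (fun n => u n - v n).
Proof.
move=> Xf Xg af ag; have := approx_linear (-1) Xg Xf ag af.
rewrite scaleN1r addrC; congr core_approx.
by apply/funext => n; rewrite scaleN1r addrC.
Qed.

(** Write E(u_n,u_n) = E(u_n, u_n - u_m) - <L u_n, u_m>. As m grows, the last term vanishes because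
    L u_n is a fixed vector and u_m tends to 0; the first is small by Cauchy-Schwarz, uniformly in
    m, because (u_n) is E-Cauchy and bounded. *)
Lemma closable u : core_approx 0 u -> cvg_for E u 0.
Proof.
move=> [Su u0 cu]; apply/real_cvgP => eps e0.
have [C C0 HC] := cauchy_for_bounded HE Su cu.
have [N HN] := (cauchy_forP HE Su).1 cu (eps / 2 / (C + 1)) ltac:(by rewrite !divr_gt0// ltr_wpDl).
exists N => n Nn; rewrite !subr0 ger0_norm; last exact: (psd_ge0 HE).
suff : E (u n) (u n) <= eps / 2 by lra.
have lim0 : E (u n) (u n) + ip (L (u n)) (u m) @[m --> \oo] --> E (u n) (u n) + 0.
  apply: cvgD; first exact: cvg_cst.
  have -> : 0 = ip (L (u n)) 0.
    by rewrite (psdC Hip) ?(psd0l Hip)//; [exact: LX|exact: LX|exact: sX.1].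
  apply: (cvg_for_ip Hip (fun=> LX (Su n)) (fun m => SX (Su m))) => //.
  - exact: LX.
  - exact: sX.1.
  - exact: (cvg_for_cst Hip).
rewrite addr0 in lim0; apply: (ler_cvg_to lim0 (cvg_cst (eps / 2))).
exists N => // m /= Nm; rewrite -[ip _ _]opprK -EL// -(psdBr HE)//.
apply: le_trans (ler_norm _) _.
have Snm : S (u n - u m) by exact: linear_subspaceB.
apply: le_trans (psd_CS_norm HE _ Snm) _ => //.
have := HN _ _ Nn Nm; rewrite ltr_pdivlMr; last by rewrite ltr_wpDl.
by have := HC n; have := psd_norm_ge0 E (u n - u m);
  have := psd_norm_ge0 E (u n); nra.
Qed.

(** The difference of two approximations of the same vector approximates 0, hence tends to 0 in
    energy by [closable]. *)
Lemma form_cvg_indep f h u v u' v' (c : R) : X f -> X h ->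
  core_approx f u -> core_approx h v -> core_approx f u' -> core_approx h v' ->
  E (u n) (v n) @[n --> \oo] --> c -> E (u' n) (v' n) @[n --> \oo] --> c.
Proof.
move=> Xf Xh au av au' av' Hc.
have nE w w' g : X g -> core_approx g w -> core_approx g w' ->
    psd_norm E (w n - w' n) @[n --> \oo] --> 0.
  move=> Xg aw aw'; have := approxB Xg Xg aw aw'; rewrite subrr => a0.
  have [Sw _ _] := a0.
  have := (cvg_forP HE Sw sS.1).1 (closable a0).
  by under eq_fun do rewrite subr0.
have nu := nE _ _ _ Xf au au'; have nv := nE _ _ _ Xh av av'.
have [[[Su _ cu] [Sv _ cv]] [[Su' _ cu'] [Sv' _ cv']]] := conj (conj au av) (conj au' av').
have [C C0 HC] := cauchy_for_bounded HE Sv cv.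
have [C' C0' HC'] := cauchy_for_bounded HE Su' cu'.
have d0 : E (u n) (v n) - E (u' n) (v' n) @[n --> \oo] --> 0.
  apply/norm_cvg0P.
  have H : psd_norm E (u n - u' n) * C + C' * psd_norm E (v n - v' n)
      @[n --> \oo] --> 0 * C + C' * 0.
    by apply: cvgD; apply: cvgM => //; exact: cvg_cst.
  rewrite mul0r mulr0 addr0 in H.
  apply: (squeeze_cvgr _ (cvg_cst 0) H); near=> n; rewrite normr_ge0/=.
  have S1 : S (u n - u' n) by exact: linear_subspaceB.
  have S2 : S (v n - v' n) by exact: linear_subspaceB.
  have -> : E (u n) (v n) - E (u' n) (v' n) =
      E (u n - u' n) (v n) + E (u' n) (v n - v' n).
    by rewrite (psdBl HE)// (psdBr HE)//; ring.
  apply: le_trans (ler_normD _ _) _; apply: lerD.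
    apply: le_trans (psd_CS_norm HE _ _) _ => //.
    by rewrite ler_wpM2l// psd_norm_ge0.
  apply: le_trans (psd_CS_norm HE _ _) _ => //.
  by rewrite ler_wpM2r// psd_norm_ge0.
have : E (u n) (v n) - (E (u n) (v n) - E (u' n) (v' n)) @[n --> \oo] --> c - 0.
  by apply: cvgB.
by rewrite subr0; under eq_fun do rewrite opprB addrC subrK.
Unshelve. all: by end_near. Qed.

Lemma form_cvg_ex f h u v : core_approx f u -> core_approx h v ->
  exists c : R, E (u n) (v n) @[n --> \oo] --> c.
Proof.
move=> [Su _ cu] [Sv _ cv]; apply: real_cauchy_cvg => eps e0.
have [C C0 HC] := cauchy_for_bounded HE Sv cv.
have [C' C0' HC'] := cauchy_for_bounded HE Su cu.
(* The increment is at most (eps / D)(C + C'); the extra 1 keeps D positive and makes the final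
   bound strict. *)
pose D := C + C' + 1.
have D0 : 0 < D by rewrite /D; lra.
have e1 : 0 < eps / D by rewrite divr_gt0.
have [N1 H1] := (cauchy_forP HE Su).1 cu _ e1.
have [N2 H2] := (cauchy_forP HE Sv).1 cv _ e1.
exists (maxn N1 N2) => n; set N := maxn _ _ => Nn.
have S1 : S (u n - u N) by exact: linear_subspaceB.
have S2 : S (v n - v N) by exact: linear_subspaceB.
have -> : E (u n) (v n) - E (u N) (v N) =
    E (u n - u N) (v n) + E (u N) (v n - v N).
  by rewrite (psdBl HE)// (psdBr HE)//; ring.
apply: le_lt_trans (ler_normD _ _) _.
have K1 := psd_CS_norm HE S1 (Sv n); have K2 := psd_CS_norm HE (Su N) S2.
have {}H1 := H1 n N (leq_trans (leq_maxl _ _) Nn) (leq_maxl _ _).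
have {}H2 := H2 n N (leq_trans (leq_maxr _ _) Nn) (leq_maxr _ _).
have K3 : psd_norm E (u n - u N) * psd_norm E (v n) <= eps / D * C.
  by rewrite ler_pM ?psd_norm_ge0 ?HC// ltW.
have K4 : psd_norm E (u N) * psd_norm E (v n - v N) <= C' * (eps / D).
  by rewrite ler_pM ?psd_norm_ge0 ?HC'// ltW.
have : eps = eps / D * C + C' * (eps / D) + eps / D.
  by rewrite /D; field; rewrite /D in D0; lra.
lra.
Qed.

Lemma form_ext_cvg f h u v : X f -> X h -> core_approx f u -> core_approx h v ->
  E (u n) (v n) @[n --> \oo] --> form_ext f h.
Proof.
move=> Xf Xh au av; have [c Hc] := form_cvg_ex au av.
have : [set c : R | exists u v, [/\ core_approx f u, core_approx h v &
  E (u n) (v n) @[n --> \oo] --> c]] (form_ext f h).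
  by apply: (xgetI _ (x := c)); exists u, v.
move=> [u' [v' [au' av' Hc']]]; exact: (form_cvg_indep Xf Xh au' av' au av Hc').
Qed.

Lemma form_ext_unique f h u v (c : R) : X f -> X h -> core_approx f u -> core_approx h v ->
  E (u n) (v n) @[n --> \oo] --> c -> form_ext f h = c.
Proof.
by move=> Xf Xh au av Hc; exact: (norm_cvg_unique (form_ext_cvg Xf Xh au av) Hc).
Qed.

Lemma form_dom_sub : S `<=` form_dom.
Proof. by move=> u Su; split; [exact: SX|exists (fun=> u); exact: approx_cst]. Qed.

Lemma form_extE u v : S u -> S v -> form_ext u v = E u v.
Proof.
move=> Su Sv; apply: (form_ext_unique (SX Su) (SX Sv) (approx_cst Su) (approx_cst Sv)).
exact: cvg_cst.
Qed.

Lemma form_ext_psd : psd_form form_dom form_ext.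
Proof.
split.
- split; first exact/form_dom_sub/sS.1.
  move=> a f g [Xf [u au]] [Xg [v av]]; split; first exact: sX.2.
  by eexists; exact: approx_linear au av.
- move=> f g [Xf [u au]] [Xg [v av]].
  apply: (form_ext_unique Xf Xg au av); have [Su _ _] := au; have [Sv _ _] := av.
  by under eq_fun do rewrite (psdC HE)//; exact: form_ext_cvg.
- move=> a f g h [Xf [u au]] [Xg [v av]] [Xh [w aw]].
  apply: (form_ext_unique _ Xh (approx_linear a Xf Xg au av) aw); first exact: sX.2.
  have [Su _ _] := au; have [Sv _ _] := av; have [Sw _ _] := aw.
  under eq_fun do rewrite (psd_linear HE)//.
  apply: cvgD; last exact: form_ext_cvg.
  by apply: cvgM; [exact: cvg_cst|exact: form_ext_cvg].
- move=> f [Xf [u au]].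
  apply: (ler_cvg_to (cvg_cst 0) (form_ext_cvg Xf Xf au au)).
  by apply: nearW => n; apply: (psd_ge0 HE); have [Su _ _] := au.
Qed.

(** When one argument is in the core, L falls on it, and only convergence in the ambient norm is
    needed for the other. *)
Lemma form_ext_gen f h : form_dom f -> S h -> form_ext f h = - ip f (L h).
Proof.
move=> [Xf [u au]] Sh.
apply: (form_ext_unique Xf (SX Sh) au (approx_cst Sh)).
have [Su uf _] := au.
under eq_fun do rewrite (psdC HE)// EL//.
apply: cvgN; rewrite (psdC Hip Xf); last exact: LX.
apply: (cvg_for_ip Hip (fun=> LX Sh) (fun n => SX (Su n)) (LX Sh) Xf) => //.
exact: (cvg_for_cst Hip).
Qed.

(** The core is dense for the energy as well: the energy of u_n - f is the limit in m of that of u_n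
    - u_m, which the Cauchy property makes small. *)
Lemma form_ext_approx f u : X f -> core_approx f u -> cvg_for form_ext u f.
Proof.
move=> Xf au; have [Su uf cu] := au; apply/real_cvgP => eps e0.
have e2 : 0 < eps / 2 by rewrite divr_gt0.
have [N HN] := cu _ e2; exists N => n Nn.
have Xn : X (u n - f) by apply: linear_subspaceB => //; exact: SX.
have an : core_approx (u n - f) (fun m => u n - u m).
  exact: approxB (SX (Su n)) Xf (approx_cst (Su n)) au.
rewrite subr0 ger0_norm; last first.
  by apply: (psd_ge0 form_ext_psd); split => //; eexists; exact: an.
suff : form_ext (u n - f) (u n - f) <= eps / 2 by lra.
apply: (ler_cvg_to (form_ext_cvg Xn Xn an an) (cvg_cst (eps / 2))).
by exists N => // m /= Nm; apply/ltW/HN.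
Qed.

End FormExtension.

(** * Kernels of closed operators inside the form domain, and projection onto them *)

Section ClosedSubspace.
Context (R : realType) (V : lmodType R) (X S : set V) (ip E : V -> V -> R).
Context (L : V -> V) (Hip : psd_form X ip) (Xc : complete_for X ip).
Context (HE : psd_form S E) (SX : S `<=` X) (LX : forall u, S u -> X (L u)).
Context (EL : forall u v, S u -> S v -> E u v = - ip (L u) v).
Let sX := psd_subspace Hip.
Let sS := psd_subspace HE.

Local Notation approx := (core_approx S ip E).
Local Notation F := (form_dom X S ip E).
Local Notation Ex := (form_ext S ip E).
Let HF := form_ext_psd Hip HE SX LX EL.

Definition form_shift (lam : R) f h := Ex f h + lam * ip f h.

Context (T : V -> V) (w : V).
Context (TX : forall u, S u -> X (T u)).
Context (Tlin : forall a u v, S u -> S v -> T (a *: u + v) = a *: T u + T v).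
Context (Xw : X w).

(** With [T] the drift and [w] the eigenvector [phi 0], this is the kernel of B in H^1 ([KerBP]);
    with both zero it is the whole form domain, as used in [form_resolvent]. *)
Definition closed_core f := [/\ X f, ip f w = 0 &
  exists2 u, approx f u & cvg_for ip (T \o u) 0].

Lemma closed_core_dom : closed_core `<=` F.
Proof. by move=> f [Xf _ [u au _]]; split=> //; exists u. Qed.

Lemma closed_core_subspace : linear_subspace closed_core.
Proof.
have T0 : T 0 = 0.
  have := Tlin 1 sS.1 sS.1; rewrite !scale1r addr0 => /eqP.
  by rewrite -subr_eq0 opprD addrA subrr sub0r oppr_eq0 => /eqP.
split.
  split; [exact: sX.1|by rewrite (psd0l Hip)|].
  exists (fun=> 0); first exact/(approx_cst Hip HE)/sS.1.
  have -> : T \o (fun=> 0) = (fun=> 0 : V) :> (nat -> V) by apply/funext => n /=.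
  exact: (cvg_for_cst Hip).
move=> a f g [Xf fw [u au Tu]] [Xg gw [v av Tv]]; split.
- exact: sX.2.
- by rewrite (psd_linear Hip)// fw gw mulr0 addr0.
- exists (fun n => a *: u n + v n); first exact: (approx_linear Hip HE).
  have [Su _ _] := au; have [Sv _ _] := av.
  have -> : T \o (fun n => a *: u n + v n) = (fun n => a *: (T \o u) n + (T \o v) n).
    by apply/funext => n /=; rewrite Tlin.
  rewrite -[0](addr0 0) -{1}(scaler0 V a).
  by apply: (cvg_for_linear Hip) => // [n|n||]; [exact: TX|exact: TX|exact: sX.1..].
Qed.

Lemma form_shift_psd (lam : R) : 0 <= lam -> psd_form F (form_shift lam).
Proof.
move=> l0; split.
- exact: (psd_subspace HF).
- move=> f g Ff Fg; rewrite /form_shift (psdC HF Ff Fg) (psdC Hip)//.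
  + by case: Ff.
  + by case: Fg.
- move=> a f g h Ff Fg Fh; rewrite /form_shift (psd_linear HF)//.
  case: Ff Fg Fh => [Xf _] [Xg _] [Xh _].
  by rewrite (psd_linear Hip)//; ring.
- move=> f Ff; rewrite addr_ge0 ?(psd_ge0 HF)// mulr_ge0// (psd_ge0 Hip)//.
  by case: Ff.
Qed.

Lemma form_norm_approx f : F f -> forall (d : R), 0 < d -> forall u, approx f u ->
  exists N, forall n, (N <= n)%N ->
    psd_norm ip (f - u n) < d /\ psd_norm Ex (f - u n) < d.
Proof.
move=> Ff d d0 u au; have [Xf _] := Ff; have [Su uf _] := au.
have Fu n : F (u n) by exact/(form_dom_sub Hip HE SX)/Su.
have c1 := (cvg_forP Hip (fun n => SX (Su n)) Xf).1 uf.
have c2 := (cvg_forP HF Fu Ff).1 (form_ext_approx Hip HE SX LX EL Xf au).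
have [N1 H1] := (real_cvgP _ _).1 c1 _ d0.
have [N2 H2] := (real_cvgP _ _).1 c2 _ d0.
exists (maxn N1 N2) => n; rewrite geq_max => /andP[/H1 + /H2].
rewrite !subr0 !ger0_norm ?psd_norm_ge0//.
rewrite (psd_normBC Hip (SX (Su n)) Xf) (psd_normBC HF (Fu n) Ff).
by [].
Qed.

Lemma inv_succ_cvg0 (a : nat -> R) : (forall n, 0 <= a n) ->
  (forall n, a n < n.+1%:R^-1) -> a n @[n --> \oo] --> 0.
Proof.
move=> a0 an; apply: (squeeze_cvgr _ (cvg_cst 0) (@cvg_harmonic R)).
by apply: nearW => n; rewrite a0/= ltW.
Qed.

(* A Cauchy sequence of [closed_core] is shadowed by a sequence of [S]        *)
(* approximating its limit.                                                   *)
Lemma closed_core_complete (lam : R) : 0 < lam -> complete_for closed_core (form_shift lam).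
Proof.
move=> l0 f Kf cf; have Hs := form_shift_psd (ltW l0).
have Ff n : F (f n) by exact/closed_core_dom/Kf.
have Xf n : X (f n) by case: (Ff n).
have [s Hs'] : {s : nat -> V & forall n, [/\ S (s n),
    psd_norm ip (f n - s n) < n.+1%:R^-1, psd_norm Ex (f n - s n) < n.+1%:R^-1 &
    psd_norm ip (T (s n)) < n.+1%:R^-1]}.
  apply: (@choice _ _ (fun n s => [/\ S s,
    psd_norm ip (f n - s) < n.+1%:R^-1, psd_norm Ex (f n - s) < n.+1%:R^-1 &
    psd_norm ip (T s) < n.+1%:R^-1])) => n.
  have [_ _ [u au Tu]] := Kf n; have n0 : 0 < n.+1%:R^-1 :> R by [].
  have [N1 H1] := form_norm_approx (Ff n) n0 au; have [Su _ _] := au.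
  have c1 := (cvg_forP Hip (fun n => TX (Su n)) sX.1).1 Tu.
  have [N2 H2] := (real_cvgP _ _).1 c1 _ n0; exists (u (maxn N1 N2)).
  have [h1 h2] := H1 _ (leq_maxl N1 N2).
  by have := H2 _ (leq_maxr N1 N2); rewrite /= !subr0 ger0_norm ?psd_norm_ge0//.
have Ss n : S (s n) by case: (Hs' n).
have Fs n : F (s n) by exact/(form_dom_sub Hip HE SX)/Ss.
have Xs n : X (s n) by exact/SX/Ss.
have sub_cauchy q : psd_form F q -> (exists2 c, 0 < c & forall x, F x ->
    c * q x x <= form_shift lam x x) -> cauchy_for q f.
  move=> Hq [c c0 Hc] eps e0; have [N HN] := cf (c * eps) (mulr_gt0 c0 e0).
  exists N => m n Nm Nn; rewrite -(ltr_pM2l c0).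
  apply: le_lt_trans (HN _ _ Nm Nn); apply: Hc.
  exact: (linear_subspaceB (psd_subspace HF)).
have FX : F `<=` X by move=> x [].
have HipF : psd_form F ip by exact: (psd_form_sub Hip (psd_subspace HF)).
have c_ip : cauchy_for ip f.
  apply: sub_cauchy => //; exists lam => // x Fx.
  by rewrite lerDr (psd_ge0 HF).
have c_Ex : cauchy_for Ex f.
  apply: sub_cauchy => //; exists 1 => // x Fx.
  by rewrite mul1r lerDl mulr_ge0 ?(ltW l0) ?(psd_ge0 HipF).
have d_ip : psd_norm ip (f n - s n) @[n --> \oo] --> 0.
  by apply: inv_succ_cvg0 => n; [exact: psd_norm_ge0|case: (Hs' n)].
have d_Ex : psd_norm Ex (f n - s n) @[n --> \oo] --> 0.
  by apply: inv_succ_cvg0 => n; [exact: psd_norm_ge0|case: (Hs' n)].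
have cs_ip := cauchy_for_close Hip Xf Xs d_ip c_ip.
have cs_Ex := cauchy_for_close HF Ff Fs d_Ex c_Ex.
have cs_E : cauchy_for E s.
  move=> eps /cs_Ex[N HN]; exists N => m n Nm Nn; have := HN _ _ Nm Nn.
  by rewrite (form_extE Hip HE SX LX EL)//; exact: linear_subspaceB.
(* The limit is taken of the core sequence [s], so that [s] itself witnesses that [p] lies in
   [closed_core]. *)
have [p Xp sp] := Xc Xs cs_ip.
have ap : approx p s by split.
have d_ip' : psd_norm ip (s n - f n) @[n --> \oo] --> 0.
  by under eq_fun do rewrite (psd_normBC Hip)//.
have fp : cvg_for ip f p := cvg_for_close Hip Xs Xf Xp d_ip' sp.
have Fp : F p by split=> //; exists s.
have fpE : cvg_for Ex f p.
  apply: (cvg_for_close HF Fs Ff Fp); last exact: (form_ext_approx Hip HE SX LX EL).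
  by under eq_fun do rewrite (psd_normBC HF)//.
exists p; last first.
  rewrite /cvg_for /form_shift -[0](addr0 0) -{2}(mulr0 lam).
  by apply: cvgD => //; apply: cvgM => //; exact: cvg_cst.
split=> //.
  have : ip (f n) w @[n --> \oo] --> ip p w.
    by apply: (cvg_for_ip Hip Xf (fun=> Xw)) => //; exact: (cvg_for_cst Hip).
  have -> : (fun n => ip (f n) w) = cst 0 by apply/funext => n; case: (Kf n).
  by move=> H; exact: (norm_cvg_unique H (cvg_cst 0)).
exists s => //; apply/(cvg_forP Hip (fun n => TX (Ss n)) sX.1).
under eq_fun do rewrite /= subr0.
by apply: inv_succ_cvg0 => n; [exact: psd_norm_ge0|case: (Hs' n)].
Qed.

Lemma closed_core_riesz (lam : R) (l : V -> R) (C : R) : 0 < lam -> 0 <= C ->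
  (forall a x y, closed_core x -> closed_core y -> l (a *: x + y) = a * l x + l y) ->
  (forall x, closed_core x -> (l x) ^+ 2 <= C * form_shift lam x x) ->
  exists2 p, closed_core p & forall eta, closed_core eta -> form_shift lam p eta = l eta.
Proof.
move=> l0 C0 ll lC; apply: (riesz C0) => //; last exact: closed_core_complete.
exact: (psd_form_sub (form_shift_psd (ltW l0)) closed_core_subspace closed_core_dom).
Qed.

(** Represent the functional a(psi, .) on the closed subspace; Cauchy-Schwarz bounds it with
    constant a(psi,psi). *)
Lemma closed_core_projection (lam : R) psi : 0 < lam -> F psi ->
  exists2 p, closed_core p & forall eta, closed_core eta ->
    form_shift lam (psi - p) eta = 0.
Proof.
move=> l0 Fpsi; have Hs := form_shift_psd (ltW l0); have KF := closed_core_dom.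
have [|||p Kp Hp] := @closed_core_riesz lam (form_shift lam psi)
    (form_shift lam psi psi) l0.
- exact: (psd_ge0 Hs).
- move=> a x y Kx Ky; rewrite (psdDr Hs) ?(psdZr Hs)//; try exact: KF.
  by apply: (linear_subspaceZ _ (psd_subspace Hs)); exact: KF.
- by move=> x Kx; apply: (psd_CS Hs) => //; exact: KF.
- exists p => // eta Ke; rewrite (psdBl Hs)// ?Hp ?subrr//; exact: KF.
Qed.

End ClosedSubspace.

(** * The weak resolvent equation and the energy estimate *)

Section Resolvent.
Context (R : realType) (V : lmodType R) (X S : set V) (ip E : V -> V -> R).
Context (L : V -> V) (Hip : psd_form X ip) (Xc : complete_for X ip).
Context (HE : psd_form S E) (SX : S `<=` X) (LX : forall u, S u -> X (L u)).
Context (EL : forall u v, S u -> S v -> E u v = - ip (L u) v).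
Let sX := psd_subspace Hip.
Let sS := psd_subspace HE.
Local Notation F := (form_dom X S ip E).
Local Notation Ex := (form_ext S ip E).
Local Notation shift := (form_shift S ip E).

Lemma form_resolvent (lam : R) g : 0 < lam -> X g ->
  exists2 f, F f & forall eta, F eta -> shift lam f eta = - ip g eta.
Proof.
move=> l0 Xg; have FX : F `<=` X by move=> x [].
have K_F eta : F eta -> closed_core X S ip E (fun=> 0) 0 eta.
  move=> [Xe [u ue]]; split => //.
    by rewrite (psdC Hip) ?(psd0l Hip)//; exact: sX.1.
  by exists u => //; exact: (cvg_for_cst Hip).
have [||||||f Kf Hf] := @closed_core_riesz _ _ _ _ _ _ _ Hip Xc HE SX LX EL
   (* The constant |g|^2 / lam comes from <g,eta>^2 <= |g|^2 |eta|^2 and lam |eta|^2 <=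
      a(eta,eta). *)
   (fun=> 0) 0 _ _ _ lam (fun eta => - ip g eta) (ip g g / lam) l0.
- by move=> *; exact: sX.1.
- by move=> *; rewrite scaler0 addr0.
- exact: sX.1.
- by rewrite divr_ge0 ?(psd_ge0 Hip)// ltW.
- move=> a x y [Xx _ _] [Xy _ _].
  rewrite (psdDr Hip) ?(psdZr Hip)//; first by ring.
  exact: linear_subspaceZ.
- move=> x [Xx _ [u au _]]; rewrite sqrrN; apply: le_trans (psd_CS Hip Xg Xx) _.
  rewrite -mulrA ler_wpM2l ?(psd_ge0 Hip)// ler_pdivlMl// lerDr.
  by apply: (psd_ge0 (form_ext_psd Hip HE SX LX EL)); split=> //; exists u.
by exists f => [|eta /K_F]; [exact: (closed_core_dom Kf)|exact: Hf].
Qed.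

(** Testing with e gives lam |e|^2 + E(e,e) = lam <g - f, e> - E(f,e). The squares of e - (g - f)
    and of 2e + f bound the right side by lam (|e|^2 + |g - f|^2) / 2 + E(e,e) + E(f,f) / 4, and the
    energy of e cancels. *)
Lemma resolvent_estimate (lam : R) (K : set V) psi g p f : 0 < lam ->
  linear_subspace K -> K `<=` F -> F psi -> X g -> K p -> K f ->
  (forall eta, F eta -> shift lam psi eta = - ip g eta) ->
  (forall eta, K eta -> shift lam (psi - p) eta = 0) ->
  forall e, e = lam *: (- p) - f ->
  ip e e <= ip (g - f) (g - f) + Ex f f / (2 * lam).
Proof.
move=> l0 sK KF Fpsi Xg Kp Kf Hpsi Hp e eE.
have HF := form_ext_psd Hip HE SX LX EL.
have Hs := form_shift_psd Hip HE SX LX EL (ltW l0).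
have sF := psd_subspace HF.
have Ke : K e.
  rewrite eE.
  apply: linear_subspaceB => //; apply: linear_subspaceZ => //.
  exact: linear_subspaceN.
have [Fe Fp Ff] : [/\ F e, F p & F f] by split; exact: KF.
have [[Xe _] [Xf _]] := (Fe, Ff).
have e1 : shift lam e e = lam * ip (g - f) e - Ex f e.
  (* The minus sign in -p, which is [Rstar] g, undoes the one in the equation a(psi,eta) = -
     <g,eta>. *)
  have E1 : shift lam (- p) e = ip g e.
    have := Hp _ Ke; rewrite (psdBl Hs)// Hpsi// (psdNl Hs)//; lra.
  rewrite {1}eE (psdBl Hs)//; last first.
    by apply: linear_subspaceZ => //; exact: linear_subspaceN.
  rewrite (psdZl Hs)//; last exact: linear_subspaceN.
  by rewrite E1 (psdBl Hip)// /form_shift; ring.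
have h1 : 0 <= ip (e - (g - f)) (e - (g - f)).
  apply: (psd_ge0 Hip); apply: linear_subspaceB => //; exact: linear_subspaceB.
rewrite (psdB_sqr Hip) in h1 => //; last exact: linear_subspaceB.
rewrite [ip e (g - f)](psdC Hip) in h1 => //; last exact: linear_subspaceB.
have h2 : 0 <= Ex (2 *: e + f) (2 *: e + f).
  by apply: (psd_ge0 HF); exact: sF.2.
rewrite (psdD_sqr HF) in h2 => //; last exact: linear_subspaceZ.
rewrite (psdZl HF) ?(psdZr HF) ?(psdZl HF) in h2 => //; last exact: linear_subspaceZ.
rewrite (psdC HF Fe Ff) in h2.
rewrite -(ler_pM2l (_ : 0 < 2 * lam)) ?mulr_gt0// mulrDr.
rewrite [2 * lam * (_ / _)]mulrC divfK ?mulf_neq0 ?gt_eqF//.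
have h3 : 0 <= lam * (ip e e - 2 * ip (g - f) e + ip (g - f) (g - f)).
  by rewrite mulr_ge0// ltW.
have := psd_ge0 HF Ff.
by move: e1; rewrite /form_shift; lra.
Qed.

End Resolvent.

(** * The space L^2 of a probability measure and its completeness *)

Section L2Space.
Context (R : realType) (d : measure_display) (T : measurableType d).
Context (P : probability T R).
Implicit Types f g h : T -> R.

Definition l2 : set (T -> R) := [set f | f \in Lfun P 2%:E].

Definition l2_ip f h : R := \int[P]_(x in setT) (f x * h x).

Lemma l2_measurable f : l2 f -> measurable_fun setT f.
Proof. by rewrite /l2/= inE => /andP[]; rewrite inE. Qed.

Lemma l2P f : measurable_fun setT f ->
  (\int[P]_(x in setT) (f x ^+ 2)%:E < +oo)%E -> l2 f.
Proof.
move=> mf fi; rewrite /l2/= inE; apply/andP; split; rewrite inE//=.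
rewrite /finite_norm unlock/= poweR_lty//.
by under eq_integral do rewrite powR_mulrn ?normr_ge0// real_normK ?num_real//.
Qed.

Lemma l2_mul_integrable f g : l2 f -> l2 g ->
  P.-integrable setT (EFin \o (fun x => f x * g x)).
Proof. by move=> lf lg; apply/Lfun1_integrable/Lfun2_mul_Lfun1. Qed.

Lemma l2_ipE f g : l2 f -> l2 g ->
  (l2_ip f g)%:E = (\int[P]_(x in setT) (f x * g x)%:E)%E.
Proof.
move=> lf lg; rewrite /l2_ip /Rintegral fineK//.
exact: (integrable_fin_num measurableT (l2_mul_integrable lf lg)).
Qed.

Lemma l2_subspace : linear_subspace l2.
Proof.
split; first exact: (Lfun_cst P 0 2).
have [_ H] := Lfun_submod_closed P (lee1n 2); move=> a x y lx ly.
exact: (H a x y lx ly).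
Qed.

Lemma l2_ip_psd : psd_form l2 l2_ip.
Proof.
split; first exact: l2_subspace.
- by move=> x y _ _; apply: eq_Rintegral => t _; rewrite mulrC.
- move=> a x y z lx ly lz; rewrite /l2_ip -RintegralZl//; last exact: l2_mul_integrable.
  rewrite -RintegralD//; last 2 first.
  + have -> : (fun t => a * (x t * z t)) = (fun t => (a *: x) t * z t).
      by apply/funext => t; rewrite mulrA.
    apply: l2_mul_integrable => //.
    by apply: linear_subspaceZ => //; exact: l2_subspace.
  + exact: l2_mul_integrable.
  by apply: eq_Rintegral => t _; rewrite mulrDl mulrA.
- by move=> x _; apply: Rintegral_ge0 => t _; rewrite -expr2 sqr_ge0.
Qed.

Lemma l2_Lnorm f : l2 f -> ('N[P]_2%:E [EFin \o f] = (psd_norm l2_ip f)%:E)%E.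
Proof.
move=> lf; rewrite unlock/=.
under eq_integral do rewrite powR_mulrn ?normr_ge0// real_normK ?num_real// expr2.
rewrite -l2_ipE// poweR_EFin powR12_sqrt//.
exact: (psd_ge0 l2_ip_psd).
Qed.

Lemma l2_cst c : l2 (cst c).
Proof. exact: Lfun_cst. Qed.

Lemma l2_norm_cst1 : psd_norm l2_ip (cst 1) = 1.
Proof.
apply: EFin_inj; rewrite -l2_Lnorm; last exact: l2_cst.
rewrite Lnorm_cst1 -[RHS](poweR1r 2^-1); congr (_ `^ _)%E.
exact: probability_setT.
Qed.

Lemma l2_bounded f (C : R) : measurable_fun setT f -> (forall x, `|f x| <= C) -> l2 f.
Proof.
move=> mf fC; apply: l2P => //.
apply: (@le_lt_trans _ _ (\int[P]_(x in setT) cst (C ^+ 2)%:E x)%E).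
  apply: ge0_le_integral => //.
  - by move=> x _; rewrite lee_fin sqr_ge0.
  - by apply/measurable_EFinP; exact: measurable_funX.
  - move=> x _; rewrite lee_fin -real_normK ?num_real// lerXn2r ?nnegrE//.
    exact: le_trans (fC x).
rewrite integral_cst//; set a := (X in (_ * X)%E).
by have -> : a = 1%E by [exact: probability_setT]; rewrite mule1 ltry.
Qed.

Lemma l2_ip_ae f g h : l2 f -> l2 g -> l2 h -> {ae P, forall x, f x = g x} ->
  l2_ip f h = l2_ip g h.
Proof.
move=> lf lg lh fg; rewrite /l2_ip /Rintegral; congr fine.
have mm k : l2 k -> measurable_fun setT (fun x => (k x * h x)%:E).
  by move=> lk; apply/measurable_EFinP/measurable_funM; exact: l2_measurable.
apply: ae_eq_integral => //; [exact: mm|exact: mm|].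
by apply: filterS fg => x -> _.
Qed.

Lemma l2_abs f : l2 f -> l2 (fun x => `|f x|).
Proof.
move=> lf; have mf := l2_measurable lf; apply: l2P; first exact: measurableT_comp.
under eq_integral do rewrite real_normK ?num_real// expr2.
by rewrite -l2_ipE// ltry.
Qed.

(** Cauchy-Schwarz against the constant 1, which has norm one under a probability. *)
Lemma l2_L1_le f : l2 f ->
  (\int[P]_(x in setT) (`|f x|)%:E <= (psd_norm l2_ip f)%:E)%E.
Proof.
move=> lf; have laf := l2_abs lf; have l1 := l2_cst 1.
have -> : (\int[P]_(x in setT) (`|f x|)%:E)%E = (l2_ip (fun x => `|f x|) (cst 1))%:E.
  by rewrite l2_ipE//; under [RHS]eq_integral do rewrite mulr1.
rewrite lee_fin; apply: le_trans (ler_norm _) _.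
apply: le_trans (psd_CS_norm l2_ip_psd laf l1) _.
rewrite l2_norm_cst1 mulr1 /psd_norm /l2_ip.
by under eq_Rintegral do rewrite -expr2 real_normK ?num_real// expr2.
Qed.

Lemma limn_einf_le (a : nat -> \bar R) c : (forall n, (a n <= c)%E) -> (limn_einf a <= c)%E.
Proof.
move=> ac; rewrite limn_einf_lim; apply: lime_le; first exact: is_cvg_einfs.
apply: nearW => n; apply: le_trans (ac n); apply: ereal_inf_lbound.
by exists n => //=.
Qed.

Lemma sum_half_le n : \sum_(0 <= k < n) (2^-1 ^+ k.+1 : R) <= 1.
Proof.
suff -> : \sum_(0 <= k < n) (2^-1 ^+ k.+1 : R) = 1 - 2^-1 ^+ n.
  by rewrite lerBlDr lerDl exprn_ge0.
elim: n => [|n IH]; first by rewrite big_geq// expr0 subrr.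
by rewrite big_nat_recr//= IH exprS; lra.
Qed.

(** The sum of |v_{k+1} - v_k| has integral at most the sum of the 2^-(k+1), so it is finite almost
    everywhere, and there the telescoping series converges absolutely. *)
Lemma l2_fast_ae_cvg (v : nat -> T -> R) : (forall k, l2 (v k)) ->
  (forall k, psd_norm l2_ip (v k.+1 - v k) <= 2^-1 ^+ k.+1) ->
  {ae P, forall x, cvgn (v ^~ x)}.
Proof.
move=> lv vk; pose h k x := v k.+1 x - v k x.
have lh k : l2 (h k).
  exact: (linear_subspaceB l2_subspace (lv k.+1) (lv k)).
have mh k : measurable_fun setT (fun x => (`|h k x|)%:E).
  by apply/measurable_EFinP/measurableT_comp => //; exact: l2_measurable.
pose G x : \bar R := (\sum_(0 <= k <oo) (`|h k x|)%:E)%E.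
have mG : measurable_fun setT G.
  by apply: ge0_emeasurable_sum => // k x _ _; rewrite lee_fin.
have G0 x : (0 <= G x)%E by apply: nneseries_ge0 => k _ _; rewrite lee_fin.
have iG : P.-integrable setT G.
  apply/integrableP; split => //.
  under eq_integral do rewrite gee0_abs//.
  rewrite /G integral_nneseries//.
  apply: (@le_lt_trans _ _ 1%E); last exact: ltry.
  apply: lime_le; first by apply: is_cvg_nneseries => k _ _; exact: integral_ge0.
  apply: nearW => n; apply: (@le_trans _ _ (\sum_(0 <= k < n) (2^-1 ^+ k.+1)%:E)%E).
    by apply: lee_sum => k _; apply: le_trans (l2_L1_le (lh k)) _; rewrite lee_fin vk.
  by rewrite sumEFin lee_fin sum_half_le.
apply: filterS (integrable_ae measurableT iG) => x /(_ I) fG.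
have H : cvgn (series (fun k => h k x)).
  apply: normed_cvg; apply: nondecreasing_is_cvgn.
    apply/nondecreasing_seqP => n; rewrite /= seriesSr lerDl.
    exact: normr_ge0.
  exists (fine (G x)) => _ [n _ <-]; rewrite -lee_fin fineK// /= /series -sumEFin.
  by apply: nneseries_lim_ge => k _; rewrite lee_fin.
have -> : v ^~ x = (fun n => series (fun k => h k x) n + v 0%N x).
  apply/funext; elim=> [|n IH]; first by rewrite /series/= big_geq// add0r.
  by rewrite /= seriesSr addrAC -IH /h addrC subrK.
by apply: is_cvgD => //; exact: is_cvg_cst.
Qed.

(** Riesz-Fischer: a rapidly Cauchy subsequence converges almost everywhere, and Fatou's lemma turns
    the Cauchy bounds into bounds on the distance to the pointwise limit. *)
Lemma l2_complete : complete_for l2 l2_ip.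
Proof.
move=> u lu cu; have Hip := l2_ip_psd.
have [N HN] : {N : nat -> nat & forall k m n, (N k <= m)%N -> (N k <= n)%N ->
    psd_norm l2_ip (u m - u n) < 2^-1 ^+ k.+1}.
  apply: (@choice _ _ (fun k Nk => forall m n, (Nk <= m)%N -> (Nk <= n)%N ->
    psd_norm l2_ip (u m - u n) < 2^-1 ^+ k.+1)) => k.
  by apply: (cauchy_forP Hip lu).1 => //; rewrite exprn_gt0.
(* Summing all earlier thresholds makes [s] monotone and at least [N k]; adding [k] makes it
   unbounded. *)
pose s k := (\sum_(i < k.+1) N i + k)%N.
have sN k : (N k <= s k)%N by rewrite /s big_ord_recr/=; lia.
have sS k : (s k <= s k.+1)%N by rewrite /s [X in (_ <= X + _)%N]big_ord_recr/=; lia.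
have sk k : (k <= s k)%N by rewrite /s leq_addl.
pose v k := u (s k).
have lv k : l2 (v k) by exact: lu.
have ae_v : {ae P, forall x, cvgn (v ^~ x)}.
  apply: l2_fast_ae_cvg => // k; apply/ltW/HN; last exact: sN.
  exact: leq_trans (sN k) (sS k).
(* The upper limit is measurable everywhere and equals the limit wherever that exists; [fine] keeps
   it real on the null set left over. *)
pose f x := fine (limn_esup (fun k => (v k x)%:E)).
have mf : measurable_fun setT f.
  apply: measurableT_comp => //; apply: measurable_fun_limn_esup => k.
  by apply/measurable_EFinP; exact: l2_measurable.
have vf : {ae P, forall x, v k x @[k --> \oo] --> f x}.
  apply: filterS ae_v => x cv; rewrite /f.
  have : (v k x)%:E @[k --> \oo] --> (limn (v ^~ x))%:E by apply: cvg_EFin => //; exact: nearW.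
  by move=> /cvg_limn_einf_sup[_ ->].
have bound eps n : 0 < eps -> (forall m, (n <= m)%N -> forall i, (n <= i)%N ->
    l2_ip (u m - u i) (u m - u i) < eps) -> forall m, (n <= m)%N ->
    (\int[P]_(x in setT) ((u m x - f x) ^+ 2)%:E <= eps%:E)%E.
  move=> e0 H m nm.
  (* The shift by [n] puts every index of the subsequence in the range where the Cauchy bound
     holds. *)
  pose F i x : \bar R := ((u m x - v (i + n)%N x) ^+ 2)%:E.
  have mF i : measurable_fun setT (F i).
    by apply/measurable_EFinP/measurable_funX/measurable_funB; exact: l2_measurable.
  have F0 i x : (0 <= F i x)%E by rewrite lee_fin sqr_ge0.
  have -> : (\int[P]_(x in setT) ((u m x - f x) ^+ 2)%:E)%E =
      (\int[P]_(x in setT) limn_einf (F ^~ x))%E.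
    apply: ae_eq_integral => //.
    - apply/measurable_EFinP/measurable_funX/measurable_funB => //; exact: l2_measurable.
    - rewrite /limn_einf; apply: measurableT_comp => //.
      by apply: measurable_fun_limn_esup => i; exact: measurableT_comp.
    - apply: filterS vf => x vx _.
      suff : F i x @[i --> \oo] --> ((u m x - f x) ^+ 2)%:E.
        by move=> /cvg_limn_einf_sup[-> _].
      apply: cvg_EFin; first exact: nearW.
      have vx' : v (i + n)%N x @[i --> \oo] --> f x.
        by rewrite (cvg_shiftn n (v ^~ x)).
      rewrite expr2; apply: cvgM; apply: cvgB => //; exact: cvg_cst.
  apply: le_trans (fatou P measurableT mF (fun i x _ => F0 i x)) _.
  apply: limn_einf_le => i; apply/ltW.
  have := H _ nm (s (i + n)%N) (leq_trans (leq_addl i n) (sk _)).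
  have lB : l2 (u m - u (s (i + n)%N)) by exact: (linear_subspaceB l2_subspace).
  by rewrite -lte_fin l2_ipE.
have cauchy' eps : 0 < eps -> exists n, forall m, (n <= m)%N -> forall i, (n <= i)%N ->
    l2_ip (u m - u i) (u m - u i) < eps.
  by move=> /cu[n Hn]; exists n => m nm i ni; exact: Hn.
have luf m : (\int[P]_(x in setT) ((u m x - f x) ^+ 2)%:E < +oo)%E -> l2 (u m - f).
  by move=> H; apply: l2P => //; apply: measurable_funB => //; exact: l2_measurable.
have lf : l2 f.
  have [n Hn] := cauchy' 1 ltr01.
  have H : l2 (u n - f).
    by apply: luf; apply: le_lt_trans (bound _ _ ltr01 Hn n (leqnn n)) (ltry _).
  by rewrite -(subKr (u n) f); exact: (linear_subspaceB l2_subspace).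
exists f => //; apply/real_cvgP => eps e0; have e2 : 0 < eps / 2 by rewrite divr_gt0.
have [n Hn] := cauchy' _ e2; exists n => m nm.
have lB : l2 (u m - f) by exact: (linear_subspaceB l2_subspace).
rewrite subr0 ger0_norm ?(psd_ge0 Hip)// (@le_lt_trans _ _ (eps / 2))//; last by lra.
by rewrite -lee_fin l2_ipE//; exact: bound e2 Hn m nm.
Qed.

End L2Space.

(** * Partial derivatives and C^n functions on open subsets of R^d *)

Lemma near_eq_differentiable (R : numFieldType) (V W : normedModType R)
    (f g : V -> W) (x : V) :
  {near x, f =1 g} -> differentiable f x -> differentiable g x.
Proof.
move=> fg df; have [cf /eqaddoP ef] := (diff_locallyP x f).1 df.
have gx : f x = g x by exact: (nbhs_singleton fg).
have eg : g \o shift x = cst (g x) + 'd f x +o_ 0 id.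
  apply/eqaddoP => eps e0; have := ef _ e0; rewrite -gx.
  have fg' : \forall h \near (0 : V), f (h + x) = g (h + x).
    by move: fg; rewrite (near_shift 0); apply: filterS => z /=; rewrite subr0 addrC.
  by apply: filterS2 fg' => h E; rewrite !fctE /= -E.
by apply/diff_locallyP; rewrite (diff_unique cf eg).
Qed.

Section Partial.
Context (R : realType) (d : nat) (V : set 'rV[R]_d) (oV : open V).
Implicit Types (F G : 'rV[R]_d -> R) (k : 'I_d).

Lemma near_open y : V y -> \forall z \near y, V z.
Proof. by move=> Vy; apply: open_nbhs_nbhs; split. Qed.

Lemma near_eq_open F G y : (forall z, V z -> F z = G z) -> V y -> {near y, F =1 G}.
Proof. by move=> FG /near_open; apply: filterS => z /FG. Qed.

Lemma partial_ext F G k y : (forall z, V z -> F z = G z) -> V y ->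
  partial k F y = partial k G y.
Proof. by move=> FG Vy; apply: near_eq_derive; exact: near_eq_open. Qed.

Lemma partialD F G k y : differentiable F y -> differentiable G y ->
  partial k (F \+ G) y = partial k F y + partial k G y.
Proof. by move=> dF dG; rewrite /partial deriveD//; exact: diff_derivable. Qed.

Lemma partialM F G k y : differentiable F y -> differentiable G y ->
  partial k (F \* G) y = partial k F y * G y + F y * partial k G y.
Proof.
move=> dF dG; rewrite /partial deriveM//; try exact: diff_derivable.
by rewrite addrC mulrC /GRing.scale/= [G y * _]mulrC [F y * _]mulrC.
Qed.

Lemma partialZ a F k y : differentiable F y ->
  partial k (fun z => a * F z) y = a * partial k F y.
Proof. by move=> dF; rewrite /partial deriveMl//; exact: diff_derivable. Qed.

Lemma partial_sum (I : finType) (F : I -> 'rV[R]_d -> R) k y :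
  (forall i, differentiable (F i) y) ->
  differentiable (fun z => \sum_i F i z) y /\
  partial k (fun z => \sum_i F i z) y = \sum_i partial k (F i) y.
Proof.
move=> dF; suff H s : differentiable (fun z => \sum_(i <- s) F i z) y /\
  partial k (fun z => \sum_(i <- s) F i z) y = \sum_(i <- s) partial k (F i) y.
  by exact: H.
elim: s => [|i s [IH1 IH2]].
  have -> : (fun z => \sum_(i <- [::]) F i z) = cst 0.
    by apply/funext => z; rewrite big_nil.
  by rewrite big_nil; split; [exact: differentiable_cst|exact: derive_cst].
have -> : (fun z => \sum_(j <- i :: s) F j z) =
    F i \+ (fun z => \sum_(j <- s) F j z).
  by apply/funext => z; rewrite big_cons.
by split; [exact: differentiableD|rewrite partialD// IH2 big_cons].
Qed.

Lemma CkS n F : Ck n.+1 V F -> Ck n V F.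
Proof.
elim: n F => [|n IH] F [dF pF]; last by split => // k; exact/IH/pF.
by move=> y /dF; exact: differentiable_continuous.
Qed.

Lemma Ck_le m n F : (m <= n)%N -> Ck n V F -> Ck m V F.
Proof.
elim: n => [|n IH]; first by rewrite leqn0 => /eqP ->.
rewrite leq_eqVlt => /predU1P[-> //|]; rewrite ltnS => mn /CkS; exact: IH.
Qed.

Lemma Ck_ext n F G : (forall y, V y -> F y = G y) -> Ck n V F -> Ck n V G.
Proof.
elim: n F G => [|n IH] F G FG.
  move=> cF y Vy; have nFG := near_eq_open FG Vy.
  rewrite /prop_for /continuous_at -FG//.
  by apply: cvg_trans (cF y Vy); exact: (near_eq_cvg nFG).
move=> [dF pF]; split.
  by move=> y Vy; apply: near_eq_differentiable (dF y Vy); exact: near_eq_open.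
by move=> k; apply: IH (pF k) => y Vy; exact: partial_ext.
Qed.

Lemma Ck_cst n c : Ck n V (cst c).
Proof.
elim: n c => [|n IH] c; first by move=> y _; exact: cst_continuous.
split; first by move=> y _; exact: differentiable_cst.
by move=> k; apply: Ck_ext (IH 0) => y _; rewrite /partial derive_cst.
Qed.

Lemma CkD n F G : Ck n V F -> Ck n V G -> Ck n V (F \+ G).
Proof.
elim: n F G => [|n IH] F G; first by move=> cF cG y Vy; exact: (continuousD (cF y Vy) (cG y Vy)).
move=> [dF pF] [dG pG]; split.
  by move=> y Vy; apply: differentiableD; [exact: dF|exact: dG].
move=> k; apply: Ck_ext (IH _ _ (pF k) (pG k)) => y Vy /=.
by rewrite partialD//; [exact: dF|exact: dG].
Qed.

Lemma Ck_mul n F G : Ck n V F -> Ck n V G -> Ck n V (F \* G).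
Proof.
elim: n F G => [|n IH] F G; first by move=> cF cG y Vy; exact: (continuousM (cF y Vy) (cG y Vy)).
move=> FS GS; have [dF pF] := FS; have [dG pG] := GS; split.
  by move=> y Vy; apply: differentiableM; [exact: dF|exact: dG].
move=> k; apply: Ck_ext (CkD (IH _ _ (pF k) (CkS GS)) (IH _ _ (CkS FS) (pG k))) => y Vy /=.
by rewrite partialM//; [exact: dF|exact: dG].
Qed.

Lemma CkZ n a F : Ck n V F -> Ck n V (fun y => a * F y).
Proof. by move=> cF; exact: (Ck_mul (Ck_cst n a) cF). Qed.

Lemma CkV n F : (forall y, V y -> F y != 0) -> Ck n V F ->
  Ck n V (fun y => (F y)^-1).
Proof.
move=> F0; elim: n => [|n IH].
  by move=> cF y Vy; exact: (continuousV (F0 y Vy) (cF y Vy)).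
move=> FS; have [dF pF] := FS; have IF := IH (CkS FS); split.
  by move=> y Vy; apply: differentiableV; [exact: dF|exact: F0].
move=> k; apply: Ck_ext (CkZ (-1) (Ck_mul (Ck_mul IF IF) (pF k))) => y Vy /=.
rewrite /partial deriveV ?F0//; last exact/diff_derivable/dF.
by rewrite mulN1r -mulNr /GRing.scale/= -exprVn expr2.
Qed.

(** By induction: the partial derivatives are those of F divided by 2 sqrt F, a quotient of C^n
    functions once sqrt F is known to be C^n. *)
Lemma Ck_sqrt n F : (forall y, V y -> 0 < F y) -> Ck n V F ->
  Ck n V (fun y => Num.sqrt (F y)).
Proof.
move=> F0; have s0 y : V y -> Num.sqrt (F y) != 0.
  by move=> Vy; rewrite sqrtr_eq0 -ltNge F0.
elim: n => [|n IH].
  move=> cF y Vy; exact: (continuous_comp (cF y Vy) (@sqrt_continuous R _)).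
move=> FS; have [dF pF] := FS; have IF := IH (CkS FS).
have ds y : V y -> differentiable (Num.sqrt : R -> R) (F y).
  move=> Vy; apply/derivable1_diffP.
  by have [] := is_derive1_sqrt (F0 y Vy).
split.
  by move=> y Vy; exact: (differentiable_comp (dF y Vy) (ds y Vy)).
move=> k; apply: Ck_ext (Ck_mul (CkV s0 IF) (CkZ 2^-1 (pF k))) => y Vy /=.
have dc : differentiable (fun z => Num.sqrt (F z)) y.
  exact: (differentiable_comp (dF y Vy) (ds y Vy)).
rewrite /partial (deriveE _ dc).
have := @diff_comp _ _ _ _ F (Num.sqrt : R -> R) y (dF y Vy) (ds y Vy).
rewrite /comp => ->.
have [sd sE] := is_derive1_sqrt (F0 y Vy).
have lin t : 'd (Num.sqrt : R -> R) (F y) t = t * (2 * Num.sqrt (F y))^-1.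
  rewrite -sE (deriveE _ (ds y Vy)) -[t in LHS]mulr1.
  exact: (linearZ_LR ('d (Num.sqrt : R -> R) (F y)) t 1).
by rewrite lin (deriveE _ (dF y Vy)) invfM; ring.
Qed.

Lemma Ck_sum n (I : finType) (F : I -> 'rV[R]_d -> R) :
  (forall i, Ck n V (F i)) -> Ck n V (fun z => \sum_i F i z).
Proof.
move=> cF; suff H s : Ck n V (fun z => \sum_(i <- s) F i z) by exact: H.
elim: s => [|i s IH].
  by apply: Ck_ext (Ck_cst n 0) => y _; rewrite big_nil.
by apply: Ck_ext (CkD (cF i) IH) => y _; rewrite big_cons.
Qed.

Lemma Ck_prod n (I : finType) (F : I -> 'rV[R]_d -> R) :
  (forall i, Ck n V (F i)) -> Ck n V (fun z => \prod_i F i z).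
Proof.
move=> cF; suff H s : Ck n V (fun z => \prod_(i <- s) F i z) by exact: H.
elim: s => [|i s IH].
  by apply: Ck_ext (Ck_cst n 1) => y _; rewrite big_nil.
by apply: Ck_ext (Ck_mul (cF i) IH) => y _; rewrite big_cons.
Qed.

Lemma Ck_det n m (A : 'rV[R]_d -> 'M[R]_m) :
  (forall i j, Ck n V (fun y => A y i j)) -> Ck n V (fun y => \det (A y)).
Proof.
move=> cA; rewrite /determinant; apply: Ck_sum => s; apply: CkZ.
by apply: Ck_prod => i; exact: cA.
Qed.

Lemma Ck_invmx n m (A : 'rV[R]_d -> 'M[R]_m) : (forall y, V y -> A y \in unitmx) ->
  (forall i j, Ck n V (fun y => A y i j)) ->
  forall i j, Ck n V (fun y => invmx (A y) i j).
Proof.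
move=> Au cA i j.
have cdet := Ck_det cA.
have d0 y : V y -> \det (A y) != 0 by move=> /Au; rewrite unitmxE unitfE.
have ccof : Ck n V (fun y => cofactor (A y) j i).
  rewrite /cofactor; apply: CkZ; apply: Ck_det => a b.
  by apply: Ck_ext (cA (lift j a) (lift i b)) => y _; rewrite !mxE.
apply: Ck_ext (Ck_mul (CkV d0 cdet) ccof) => y Vy.
by rewrite /invmx Au// !mxE.
Qed.

Lemma differentiable_sub F n y : Ck n.+1 V F -> V y -> differentiable F y.
Proof. by case=> dF _; exact: dF. Qed.

End Partial.

(** * Jacobi's formula for the derivative of a determinant *)

Section Jacobi.
Context (R : realType) (d : nat).

Lemma partial_prod (I : finType) (F : I -> 'rV[R]_d -> R) k y :
  (forall i, differentiable (F i) y) ->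
  partial k (fun z => \prod_i F i z) y =
  \sum_i partial k (F i) y * \prod_(j | j != i) F j y.
Proof.
(* Without repetitions, the condition j != i removes exactly one factor of the product. *)
move=> dF; suff H s : uniq s -> differentiable (fun z => \prod_(i <- s) F i z) y /\
    partial k (fun z => \prod_(i <- s) F i z) y =
    \sum_(i <- s) partial k (F i) y * \prod_(j <- s | j != i) F j y.
  by have [] := H _ (index_enum_uniq I).
elim: s => [_|i s IH].
  have -> : (fun z => \prod_(i <- [::]) F i z) = cst 1.
    by apply/funext => z; rewrite big_nil.
  by rewrite big_nil; split; [exact: differentiable_cst|exact: derive_cst].
move=> /= /andP[si us]; have [IH1 IH2] := IH us.
have -> : (fun z => \prod_(j <- i :: s) F j z) =
    F i \* (fun z => \prod_(j <- s) F j z).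
  by apply/funext => z; rewrite big_cons.
split; first exact: differentiableM.
rewrite partialM// IH2 big_cons big_cons eqxx/=; congr (_ * _ + _).
  rewrite big_seq_cond [RHS]big_seq_cond; apply: eq_bigl => j.
  by case: eqP => [->|]; rewrite ?(negPf si) ?andbT.
rewrite big_distrr/= big_seq [RHS]big_seq; apply: eq_bigr => j js.
rewrite big_cons; case: eqP => [ij|_]; first by rewrite ij js in si.
by rewrite mulrCA.
Qed.

(** Both sides equal the sum over i of the determinant of A with row i replaced by that of B: one by
    Leibniz's formula, the other by expansion along row i. *)
Lemma det_deriv m (A B : 'M[R]_m) :
  \sum_(s : 'S_m) (-1) ^+ s * (\sum_i B i (s i) * \prod_(j | j != i) A j (s j)) =
  \sum_i \sum_j B i j * cofactor A i j.
Proof.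
pose C i := \matrix_(a, b) (if a == i then B i b else A a b).
have CE i : \det (C i) = \sum_j B i j * cofactor A i j.
  rewrite (expand_det_row _ i); apply: eq_bigr => j _; rewrite mxE eqxx.
  congr (_ * (_ * \det _)); apply/matrixP => a b; rewrite !mxE.
  by rewrite eq_sym (negPf (neq_lift _ _)).
under [RHS]eq_bigr do rewrite -CE.
under [LHS]eq_bigr do rewrite mulr_sumr.
rewrite exchange_big/=; apply: eq_bigr => i _; apply: eq_bigr => s _.
congr (_ * _); rewrite [RHS](bigD1 i)//= mxE eqxx; congr (_ * _).
by apply: eq_bigr => j ji; rewrite mxE (negPf ji).
Qed.

Lemma partial_det m (A : 'rV[R]_d -> 'M[R]_m) k y :
  (forall i j, differentiable (fun z => A z i j) y) ->
  partial k (fun z => \det (A z)) y =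
  \sum_i \sum_j partial k (fun z => A z i j) y * cofactor (A y) i j.
Proof.
move=> dA; pose B := \matrix_(i, j) partial k (fun z => A z i j) y.
transitivity (\sum_i \sum_j B i j * cofactor (A y) i j); last first.
  by apply: eq_bigr => i _; apply: eq_bigr => j _; rewrite mxE.
rewrite -det_deriv /determinant.
have dprod (s : 'S_m) : differentiable (fun z => \prod_i A z i (s i)) y.
  suff H r : differentiable (fun z => \prod_(i <- r) A z i (s i)) y by exact: H.
  elim: r => [|i r IH].
    have -> : (fun z => \prod_(i <- [::]) A z i (s i)) = cst 1.
      by apply/funext => z; rewrite big_nil.
    exact: differentiable_cst.
  have -> : (fun z => \prod_(j <- i :: r) A z j (s j)) =
      (fun z => A z i (s i)) \* (fun z => \prod_(j <- r) A z j (s j)).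
    by apply/funext => z; rewrite big_cons.
  exact: differentiableM.
have [|_ ->] := partial_sum (F := fun (s : 'S_m) z => (-1) ^+ s * \prod_i A z i (s i)) k (y := y).
  by move=> s; apply: differentiableM => //; exact: differentiable_cst.
apply: eq_bigr => s _; rewrite partialZ// (partial_prod k (F := fun i z => A z i (s i)))//.
by congr (_ * _); apply: eq_bigr => i _; rewrite mxE.
Qed.

End Jacobi.

(** * Symmetry of mixed second derivatives *)

Lemma dist_halves (R : realType) (a b c e : R) :
  `|c - a| < e / 2 -> `|c - b| < e / 2 -> `|a - b| <= e.
Proof. by rewrite !ltr_norml ler_norml => /andP[? ?] /andP[? ?]; lra. Qed.

Section Schwarz.
Context (R : realType) (U : normedModType R).
Implicit Types (F : U -> R) (a u v : U).

Lemma is_derive_line F a v (s : R) : derivable F (a + s *: v) v ->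
  is_derive s 1 (fun r : R => F (a + r *: v)) ('D_v F (a + s *: v)).
Proof.
have E : (fun h : R => h^-1 *: (((fun r : R => F (a + r *: v)) \o shift s) (h *: (1 : R))
      - F (a + s *: v))) =
    (fun h : R => h^-1 *: ((F \o shift (a + s *: v)) (h *: v) - F (a + s *: v))).
  apply/funext => h; congr (_ *: (F _ - _)); rewrite /= [h *: _]mulr1 scalerDl.
  by rewrite addrCA.
by move=> dF; split; rewrite ?/derivable ?/derive E.
Qed.

Lemma mean_value (g dg : R -> R) (t : R) : 0 < t ->
  (forall s, 0 <= s <= t -> is_derive s 1 g (dg s)) ->
  exists2 c, 0 < c < t & g t - g 0 = t * dg c.
Proof.
move=> t0 dgP; have [||c ct E] := @MVT R g dg 0 t t0.
- by move=> s; rewrite in_itv/= => /andP[s0 st]; apply: dgP; rewrite !ltW.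
- apply: derivable_within_continuous => s; rewrite in_itv/= => st.
  by have [] := dgP _ st.
- by exists c; [rewrite in_itv in ct|rewrite E subr0 mulrC].
Qed.

(** The mean value theorem is applied to s -> F(a + tv + su) - F(a + su), then to the derivative
    along u on a segment in direction v. *)
Lemma second_difference F a u v (t : R) : 0 < t ->
  (forall p q, 0 <= p <= t -> 0 <= q <= t -> differentiable F (a + p *: u + q *: v)
    /\ differentiable ('D_u F) (a + p *: u + q *: v)) ->
  exists p q, [/\ 0 < p < t, 0 < q < t & F (a + t *: u + t *: v) - F (a + t *: u)
     - F (a + t *: v) + F a = t ^+ 2 * 'D_v ('D_u F) (a + p *: u + q *: v)].
Proof.
move=> t0 dF; have t00 : 0 <= (0 : R) <= t by rewrite lexx ltW.
have ttt : 0 <= t <= t by rewrite lexx ltW.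
pose g s := F (a + t *: v + s *: u) - F (a + s *: u).
have [p p0 Ep] : exists2 p, 0 < p < t & g t - g 0 =
    t * ('D_u F (a + t *: v + p *: u) - 'D_u F (a + p *: u)).
  apply: mean_value => // s st; apply: is_deriveB; apply: is_derive_line;
    apply: diff_derivable.
    by rewrite addrAC; exact: (dF s t st ttt).1.
  by have := (dF s 0 st t00).1; rewrite scale0r addr0.
have pt : 0 <= p <= t by case/andP: p0 => *; rewrite !ltW.
have duF s : 0 <= s <= t -> is_derive s 1 (fun r : R => 'D_u F (a + p *: u + r *: v))
    ('D_v ('D_u F) (a + p *: u + s *: v)).
  by move=> st; apply: is_derive_line; apply: diff_derivable; exact: (dF p s pt st).2.
have [q q0 Eq] := mean_value t0 duF.
exists p, q; split => //; rewrite expr2 -mulrA -Eq scale0r addr0.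
rewrite [a + p *: u + t *: v]addrAC -Ep /g scale0r !addr0.
by rewrite [a + t *: v + t *: u]addrAC; ring.
Qed.

(** The second difference on a small parallelogram is symmetric in u and v, so the two mixed
    derivatives agree at a pair of points near y; continuity carries this to y. *)
Lemma schwarz (V : set U) F u v y : open V -> V y ->
  (forall z, V z -> differentiable F z) ->
  (forall z, V z -> differentiable ('D_u F) z) ->
  (forall z, V z -> differentiable ('D_v F) z) ->
  {for y, continuous ('D_v ('D_u F))} -> {for y, continuous ('D_u ('D_v F))} ->
  'D_v ('D_u F) y = 'D_u ('D_v F) y.
Proof.
move=> oV Vy dF duF dvF cvu cuv; apply/eqP; rewrite -subr_eq0 -normr_le0.
apply/ler_addgt0Pl => /= eps e0; rewrite addr0.
have e2 : 0 < eps / 2 by rewrite divr_gt0.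
have nV : nbhs y V by apply: open_nbhs_nbhs; split.
have /cvgrPdistC_lt/(_ _ e2) n1 := cvu; have /cvgrPdistC_lt/(_ _ e2) n2 := cuv.
have [r /= r0 Hr] := (nbhs_ballP _ _).1 (filterI (filterI n1 n2) nV).
(* Small enough for the parallelogram with sides tu and tv to stay in the ball of radius r; the 1
   covers u = v = 0. *)
pose t := r / (2 * (`|u| + `|v| + 1)).
have D0 : 0 < `|u| + `|v| + 1 by rewrite ltr_wpDl// addr_ge0.
have t0 : 0 < t by rewrite divr_gt0// mulr_gt0.
have Hb p q w z : 0 <= p <= t -> 0 <= q <= t -> (w = u /\ z = v) \/ (w = v /\ z = u) ->
    ball y r (y + p *: w + q *: z).
  move=> /andP[p0 pt] /andP[q0 qt] wz.
  rewrite -ball_normE/= -addrA opprD addrA subrr add0r normrN.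
  apply: le_lt_trans (ler_normD _ _) _; rewrite !normrZ !ger0_norm//.
  apply: (@le_lt_trans _ _ (t * (`|u| + `|v|))).
    case: wz => -[-> ->]; rewrite mulrDr; first by apply: lerD; rewrite ler_wpM2r.
    by rewrite [leRHS]addrC; apply: lerD; rewrite ler_wpM2r.
  apply: (@lt_le_trans _ _ (t * (2 * (`|u| + `|v| + 1)))).
    by rewrite ltr_pM2l//; have := normr_ge0 u; have := normr_ge0 v; lra.
  by rewrite /t divfK ?gt_eqF ?mulr_gt0.
have weak x : 0 < x < t -> 0 <= x <= t by case/andP => *; rewrite !ltW.
have [p [q [p0 q0 E1]]] := @second_difference F y u v t t0 (fun p q hp hq =>
  let Vz := (Hr _ (Hb p q u v hp hq (or_introl (conj erefl erefl)))).2 in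
  conj (dF _ Vz) (duF _ Vz)).
have [p' [q' [p0' q0' E2]]] := @second_difference F y v u t t0 (fun p q hp hq =>
  let Vz := (Hr _ (Hb p q v u hp hq (or_intror (conj erefl erefl)))).2 in
  conj (dF _ Vz) (dvF _ Vz)).
have := (Hr _ (Hb p q u v (weak _ p0) (weak _ q0) (or_introl (conj erefl erefl)))).1.1.
have := (Hr _ (Hb p' q' v u (weak _ p0') (weak _ q0') (or_intror (conj erefl erefl)))).1.2.
have E : 'D_v ('D_u F) (y + p *: u + q *: v) = 'D_u ('D_v F) (y + p' *: v + q' *: u).
  apply: (@mulfI _ (t ^+ 2)); first by rewrite expf_neq0 ?gt_eqF.
  apply: etrans (esym E1) _; apply: etrans E2.
  by rewrite [y + t *: v + t *: u]addrAC; congr (_ + _); exact: addrAC.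
by rewrite -E => h2 h1; exact: dist_halves h1 h2.
Qed.

End Schwarz.

(** * Invariance of the divergence under a change of coordinates *)

Section ChangeOfCoordinates.
Context (R : realType) (d : nat) (V W : set 'rV[R]_d) (oV : open V).
Context (tau : 'rV[R]_d -> 'rV[R]_d) (VW : forall y, V y -> W (tau y)).
Context (tauS : forall m, Ck 2 V (fun y => tau y 0 m)).
Local Notation J := (jacobian tau).

Lemma Ck2_schwarz F k l y : Ck 2 V F -> V y ->
  partial k (partial l F) y = partial l (partial k F) y.
Proof.
move=> [dF pF] Vy; apply: (schwarz oV Vy dF).
- exact: (pF l).1.
- exact: (pF k).1.
- exact: ((pF l).2 k).
- exact: ((pF k).2 l).
Qed.

Lemma tau_diff y : V y -> differentiable tau y.
Proof.
move=> Vy; have -> : tau = \sum_(m < d) (fun z => tau z 0 m *: delta_mx 0 m).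
  apply/funext => z; rewrite fct_sumE [LHS]row_sum_delta.
  by [].
by apply: differentiable_sum => m; apply: differentiableZl; exact: (tauS m).1.
Qed.

Lemma jacobianE k m y : V y -> J y k m = partial k (fun z => tau z 0 m) y.
Proof.
move=> Vy; have dt := tau_diff Vy.
have := deriveEjacobian (delta_mx 0 k) dt; rewrite -rowE => E.
have -> : J y k m = (row k (J y)) 0 m by rewrite [RHS]mxE.
have dd : derivable tau y (delta_mx 0 k : 'rV[R]_d) by exact: diff_derivable.
by rewrite -E (derive_mx dd) mxE.
Qed.

Lemma partial_comp F k y : V y -> differentiable F (tau y) ->
  partial k (fun z => F (tau z)) y = \sum_m J y k m * partial m F (tau y).
Proof.
move=> Vy dF; have dt := tau_diff Vy.
rewrite -[fun z => F (tau z)]/(F \o tau) /partial.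
rewrite (deriveE _ (differentiable_comp dt dF)) (diff_comp dt dF) /=.
rewrite -(deriveE _ dt) deriveEjacobian// -rowE [row k _]row_sum_delta linear_sum.
apply: eq_bigr => m _; rewrite mxE linearZ_LR /= deriveE//.
Qed.

Lemma jacobian_C1 k m : Ck 1 V (fun y => J y k m).
Proof.
apply: (@Ck_ext _ _ _ oV 1 (partial k (fun z => tau z 0 m))).
  by move=> y Vy; rewrite jacobianE.
exact: (tauS m).2.
Qed.

Context (X Y : 'rV[R]_d -> 'rV[R]_d) (rho sigma : 'rV[R]_d -> R).
Context (XS : forall k, Ck 1 V (fun y => X y 0 k)).
Context (YS : forall k, Ck 1 W (fun y => Y y 0 k)).
Context (rhoS : Ck 1 V rho) (sigmaS : Ck 1 W sigma).
Context (YX : forall y, V y -> Y (tau y) = X y *m J y).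
Context (rho_sigma : forall y, V y -> rho y = \det (J y) * sigma (tau y)).
Context (sigma0 : forall y, W y -> sigma y != 0).
Context (J0 : forall y, V y -> \det (J y) != 0).

Lemma divergence_expand (Z : 'rV[R]_d -> 'rV[R]_d) (r : 'rV[R]_d -> R) y :
  r y != 0 -> differentiable r y -> (forall k, differentiable (fun z => Z z 0 k) y) ->
  (r y)^-1 * \sum_k partial k (fun z => r z * Z z 0 k) y =
  \sum_k Z y 0 k * (partial k r y / r y) + \sum_k partial k (fun z => Z z 0 k) y.
Proof.
move=> r0 dr dZ; rewrite mulr_sumr -big_split/=; apply: eq_bigr => k _.
by rewrite partialM//; field.
Qed.

(* The second-order terms cancel because, the mixed derivatives of [tau]      *)
(* being symmetric, they are the derivative of [ln (\det J)] along [X].       *)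
Lemma divergence_change y : V y ->
  (rho y)^-1 * \sum_k partial k (fun z => rho z * X z 0 k) y =
  (sigma (tau y))^-1 * \sum_k partial k (fun z => sigma z * Y z 0 k) (tau y).
Proof.
move=> Vy; have Wy := VW Vy; have dJ := jacobian_C1.
have ds : differentiable sigma (tau y) by exact: sigmaS.1.
have dY m : differentiable (fun z => Y z 0 m) (tau y) by exact: (YS m).1.
have dX m : differentiable (fun z => X z 0 m) y by exact: (XS m).1.
have dJy k m : differentiable (fun z => J z k m) y by exact: (dJ k m).1.
rewrite !divergence_expand//; [|exact: sigma0| |exact: rhoS.1]; last first.
  by rewrite rho_sigma// mulf_neq0 ?J0 ?sigma0.
have uJ : J y \in unitmx by rewrite unitmxE unitfE J0.
pose K := invmx (J y).
pose DJ k := \matrix_(i, j) partial k (fun z => J z i j) y.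
(* Logarithmic derivative of det J times sigma o tau: Jacobi's formula for the first factor, the
   chain rule for the second. *)
have drho k : partial k rho y / rho y = \tr (DJ k *m K) +
    \sum_m J y k m * (partial m sigma (tau y) / sigma (tau y)).
  have -> : partial k rho y =
      partial k (fun z => \det (J z)) y * sigma (tau y) +
      \det (J y) * \sum_m J y k m * partial m sigma (tau y).
    rewrite (partial_ext oV _ rho_sigma)// partialM ?partial_comp//.
      by apply: (differentiable_sub (Ck_det oV dJ)).
    by apply: differentiable_comp => //; exact: tau_diff.
  have -> : partial k (fun z => \det (J z)) y = \det (J y) * \tr (DJ k *m K).
    rewrite partial_det// /K /invmx uJ -scalemxAr mxtraceZ.
    rewrite mulrA mulfV ?J0// mul1r /mxtrace; apply: eq_bigr => i _.
    by rewrite mxE; apply: eq_bigr => j _; rewrite !mxE.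
  rewrite rho_sigma// mulrDl; congr (_ + _).
    by field; rewrite J0//= sigma0.
  under [RHS]eq_bigr do rewrite mulrA.
  by rewrite -mulr_suml; field; rewrite J0//= sigma0.
under eq_bigr do rewrite drho mulrDr.
rewrite big_split/= -addrA addrCA; congr (_ + _).
  under eq_bigr do rewrite mulr_sumr.
  rewrite exchange_big/=; apply: eq_bigr => m _.
  by rewrite YX// mxE mulr_suml; apply: eq_bigr => k _; exact: mulrA.
pose DX := \matrix_(i, j) partial i (fun z => X z 0 j) y.
pose DY := \matrix_(i, j) partial i (fun z => Y z 0 j) (tau y).
(* Differentiate Y o tau = X J. Symmetry of second derivatives replaces the p-th derivative of J_km
   by the k-th derivative of J_pm, so that J is differentiated along X. *)
have JDY : J y *m DY = DX *m J y + \sum_k X y 0 k *: DJ k.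
  apply/matrixP => p m; transitivity (partial p (fun z => Y (tau z) 0 m) y).
    rewrite (partial_comp p Vy (dY m)) mxE; apply: eq_bigr => k _.
    by rewrite [DY _ _]mxE.
  rewrite (partial_ext oV (G := fun z => \sum_k X z 0 k * J z k m))//; last first.
    by move=> z Vz; rewrite YX// mxE.
  have [k|_ ->] := partial_sum (F := fun k z => X z 0 k * J z k m) p (y := y).
    exact: differentiableM.
  rewrite mxE [(DX *m _) p m]mxE summxE -big_split/=; apply: eq_bigr => k _.
  rewrite partialM// [DX _ _]mxE [(X y 0 k *: DJ k) p m]mxE [DJ _ _ _]mxE; congr (_ + _ * _).
  rewrite (partial_ext oV (G := partial k (fun z => tau z 0 m)))//; last first.
    by move=> z Vz; rewrite jacobianE.
  rewrite Ck2_schwarz//; apply: (partial_ext oV) => // z Vz.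
  by rewrite jacobianE.
have -> : \sum_k partial k (fun z => Y z 0 k) (tau y) = \tr DY.
  by apply: eq_bigr => k _; rewrite mxE.
have -> : DY = K *m (DX *m J y + \sum_k X y 0 k *: DJ k).
  by rewrite -JDY mulmxA mulVmx// mul1mx.
rewrite mulmxDr mxtraceD mxtrace_mulC -mulmxA mulmxV// mulmx1 addrC; congr (_ + _).
  by apply: eq_bigr => k _; rewrite mxE.
rewrite mulmx_sumr raddf_sum/=; apply: eq_bigr => k _.
by rewrite -scalemxAr mxtraceZ mxtrace_mulC.
Qed.

End ChangeOfCoordinates.

(** On the segment (1 - t) I + t G all matrices are positive definite, so the polynomial t -> det((1
    - t) I + t G) has no root in [0,1]. It is 1 at t = 0, and the intermediate value theorem forbids
    a nonpositive value at t = 1. *)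
Lemma posdef_det_gt0 (R : realType) (d : nat) (G : 'M[R]_d) :
  (forall v : 'rV[R]_d, v != 0 -> 0 < (v *m G *m v^T) 0 0) -> 0 < \det G.
Proof.
move=> Gpos; pose A : 'M[{poly R}]_d := (1 - 'X)%:M + 'X *: map_mx polyC G.
pose q := \det A.
have qE t : q.[t] = \det ((1 - t)%:M + t *: G).
  rewrite /q -[_.[t]]/(horner_eval t _) -det_map_mx; congr (\det _).
  apply/matrixP => i j; rewrite !mxE /= /horner_eval.
  by case: (i == j); rewrite ?mulr1n ?mulr0n !hornerE.
have nz t : 0 <= t <= 1 -> \det ((1 - t)%:M + t *: G) != 0.
  move=> /andP[t0 t1]; apply/negP => /det0P[v v0 vA].
  have : ((v *m ((1 - t)%:M + t *: G)) *m v^T) 0 0 = 0 by rewrite vA mul0mx mxE.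
  have E1 : (v *m (1 - t)%:M *m v^T) 0 0 = (1 - t) * (v *m v^T) 0 0.
    by rewrite mul_mx_scalar -scalemxAl mxE.
  have E2 : (v *m (t *: G) *m v^T) 0 0 = t * (v *m G *m v^T) 0 0.
    by rewrite -scalemxAr -scalemxAl mxE.
  rewrite mulmxDr mulmxDl mxE E1 E2 => H.
  have vv : 0 < (v *m v^T) 0 0.
    rewrite mxE lt_def sumr_ge0 ?andbT; last first.
      by move=> i _; rewrite mxE -expr2 sqr_ge0.
    apply: contra_neq v0 => /psumr_eq0P vi; apply/rowP => i; rewrite mxE.
    have := vi (fun i _ => ltac:(by rewrite mxE -expr2 sqr_ge0)) i isT.
    by rewrite mxE -expr2 => /eqP; rewrite sqrf_eq0 => /eqP.
  (* Both terms of the convex combination are nonnegative; the split at 1/2 decides which one is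
     certainly positive. *)
  have vG := Gpos v v0; have [t12|t12] := ltP t (1 / 2).
    have : 0 < (1 - t) * (v *m v^T) 0 0 by rewrite mulr_gt0//; lra.
    by have : 0 <= t * (v *m G *m v^T) 0 0 by [rewrite mulr_ge0// ltW]; lra.
  have : 0 < t * (v *m G *m v^T) 0 0 by rewrite mulr_gt0//; lra.
  by have : 0 <= (1 - t) * (v *m v^T) 0 0 by [rewrite mulr_ge0 ?subr_ge0// ltW]; lra.
have q1 : q.[1] = \det G by rewrite qE subrr scale1r raddf0 add0r.
have q0 : q.[0] = 1 by rewrite qE subr0 scale0r addr0 det1.
rewrite ltNge; apply/negP => G0.
have [|x] := @poly_ivt _ (- q) 0 1 ler01.
  by rewrite !hornerE q0 q1 oppr_ge0 G0 lerN10.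
move=> x01; rewrite rootN /root qE => /eqP H.
by have := nz x x01; rewrite H eqxx.
Qed.

(** * Chart independence, continuity and product rules on the manifold *)

Section Manifold.
Context (R : realType) (d : nat) (M : orientedRiemannianManifold R d).
Local Notation D i := (chart (o := M) i @` dom (o := M) i).
Local Notation J i j := (jacobian (transition (o := M) i j)).
Implicit Types (i j : chart_index M) (f h U : M -> R) (X Y : field_components M).

Lemma dom_nbhs i (x : M) : dom i x -> nbhs x (dom (o := M) i).
Proof. by move=> ?; apply: open_nbhs_nbhs; split=> //; exact: dom_open. Qed.

Lemma chart_imageK i y : D i y -> dom (o := M) i (cochart i y) /\ chart i (cochart (o := M) i y) = y.
Proof. by case=> x dx <-; rewrite chartK. Qed.

Lemma overlapP i j y : overlap (o := M) i j y <-> D i y /\ dom (o := M) j (cochart i y).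
Proof.
split=> [[x [dx jx] <-]|[Dy jy]].
  by rewrite chartK//; split=> //; exists x.
by have [iy E] := chart_imageK Dy; exists (cochart i y).
Qed.

Lemma overlap_open i j : open (overlap (o := M) i j).
Proof.
rewrite openE => y /overlapP[Dy jy].
have n1 := near_open (@chart_open _ _ M i) Dy.
have n2 : \forall z \near y, dom (o := M) j (cochart i z).
  exact: (@cochart_continuous _ _ M i y Dy _ (dom_nbhs jy)).
by apply: filterS2 n1 n2 => z Dz jz; apply/overlapP.
Qed.

Lemma overlap_chart i j (x : M) : dom i x -> dom j x -> overlap (o := M) i j (chart i x).
Proof. by move=> ix jx; exists x. Qed.

Lemma transition_chart i j (x : M) : dom i x -> transition (o := M) i j (chart i x) = chart j x.
Proof. by move=> ix; rewrite /transition/= chartK. Qed.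

Lemma overlap_sub i j y : overlap (o := M) i j y -> D i y.
Proof. by case/overlapP. Qed.

Lemma transition_image i j y : overlap (o := M) i j y -> D j (transition (o := M) i j y).
Proof. by case/overlapP => _ jy; exists (cochart i y). Qed.

Lemma jacobian_det0 i j y : overlap (o := M) i j y -> \det (J i j y) != 0.
Proof. by move=> /transition_oriented/gt_eqF ->. Qed.

Lemma metric_det i y : D i y -> 0 < \det (metric (o := M) i y).
Proof. by move=> Dy; apply: posdef_det_gt0 => v; exact: metric_pos. Qed.

Lemma metric_unit i y : D i y -> metric (o := M) i y \in unitmx.
Proof. by move=> /metric_det/gt_eqF H; rewrite unitmxE unitfE H. Qed.

Lemma Ck_volume n i : Ck n (D i) (fun y => Num.sqrt (\det (metric (o := M) i y))).
Proof.
apply: Ck_sqrt; [exact: chart_open|exact: metric_det|].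
by apply: Ck_det => [|k l]; [exact: chart_open|exact: metric_smooth].
Qed.

Lemma volume_neq0 i y : D i y -> Num.sqrt (\det (metric (o := M) i y)) != 0.
Proof. by move=> Dy; rewrite sqrtr_eq0 -ltNge metric_det. Qed.

Definition grad_row f i y : 'rV[R]_d := \row_k partial k (f \o cochart (o := M) i) y.

Lemma Ck_grad n f i k : CkM n.+1 f -> Ck n (D i) (fun y => grad f i y 0 k).
Proof.
move=> fS; have oD := @chart_open _ _ M i.
have [_ pF] := fS i.
have gS := Ck_invmx oD (@metric_unit i) (fun a b => @metric_smooth _ _ M i a b n).
have := Ck_sum oD (fun l => Ck_mul oD (pF l) (gS l k)).
by apply: (Ck_ext oD) => y Dy; rewrite !mxE; apply: eq_bigr => l _; rewrite mxE.
Qed.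

Lemma grad_row_change f i j y : CkM 1 f -> overlap (o := M) i j y ->
  grad_row f i y = grad_row f j (transition i j y) *m (J i j y)^T.
Proof.
move=> fS oy; apply/rowP => k; rewrite !mxE.
have oV := @overlap_open i j.
rewrite (partial_ext oV (G := fun z => (f \o cochart j) (transition i j z)))//.
  rewrite (partial_comp (fun m => @transition_smooth _ _ M i j m 2) k oy).
    by apply: eq_bigr => m _; rewrite !mxE mulrC.
  by apply: (fS j).1; exact: transition_image.
by move=> z /overlapP[_ jz]; rewrite /transition/= chartK.
Qed.

Definition vector_field X := forall i j y, overlap (o := M) i j y ->
  X j (transition i j y) = X i y *m J i j y.

(** Partial derivatives change by the transposed Jacobian. The inverse metric, which changes by
    inverse Jacobians on both sides, cancels this factor and leaves the rule of a tangent vector. *)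
Lemma grad_field f : CkM 1 f -> vector_field (grad f).
Proof.
move=> fS i j y oy; rewrite /grad -!/(grad_row f _ _) (grad_row_change fS oy).
have Jn := jacobian_det0 oy; have uJ : J i j y \in unitmx by rewrite unitmxE unitfE.
have uJT : (J i j y)^T \in unitmx by rewrite unitmx_tr.
have uG := metric_unit (transition_image oy).
rewrite (metric_change oy); set G := metric j _ in uG *; set K := J i j y in uJ uJT *.
set r := grad_row f j _.
have E : r *m K^T = (r *m invmx G *m invmx K) *m (K *m G *m K^T).
  by rewrite !mulmxA mulmxKV// mulmxKV.
by rewrite E mulmxK ?mulmxKV// !unitmx_mul uJ uG.
Qed.

Definition chart_inner i X Y y := (X i y *m metric i y *m (Y i y)^T) 0 0.

Lemma innerE X Y i (x : M) : vector_field X -> vector_field Y -> dom i x ->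
  inner X Y x = chart_inner i X Y (chart i x).
Proof.
move=> fX fY ix; have cx := dom_chart_at x; set j := chart_at x in cx *.
have oy := overlap_chart ix cx.
rewrite /inner /chart_inner -/j -(transition_chart j ix) (fX _ _ _ oy) (fY _ _ _ oy).
by rewrite (metric_change oy) trmx_mul !mulmxA.
Qed.

Definition chart_div i X y := (Num.sqrt (\det (metric i y)))^-1 *
  \sum_(k < d) partial k (fun z => Num.sqrt (\det (metric i z)) * X i z 0 k) y.

Lemma divergenceE X i (x : M) : vector_field X ->
  (forall i k, Ck 1 (D i) (fun y => X i y 0 k)) -> dom i x ->
  divergence X x = chart_div i X (chart i x).
Proof.
move=> fX XS ix; have cx := dom_chart_at x; set j := chart_at x in cx *.
have oy := overlap_chart ix cx.
have sub n F : Ck n (D i) F -> Ck n (overlap i j) F.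
  elim: n F => [|n IH] F; first by move=> H y /overlap_sub; exact: H.
  by move=> [dF pF]; split=> [y /overlap_sub|k]; [exact: dF|exact/IH/pF].
rewrite /divergence /chart_div -/j -(transition_chart j ix).
apply/esym/(divergence_change (V := overlap i j) (W := D j)) => //.
- exact: overlap_open.
- exact: transition_image.
- by move=> m; exact: transition_smooth.
- by move=> k; apply: sub; exact: XS.
- by apply: sub; exact: Ck_volume.
- exact: Ck_volume.
- exact: fX.
(* The metric determinant is multiplied by (det J)^2; orientation makes its square root det J
   itself, without absolute value. *)
- move=> y oy'; rewrite (metric_change oy') !det_mulmx det_tr mulrAC -expr2.
  rewrite sqrtrM ?sqr_ge0// sqrtr_sqr ger0_norm// ltW//; exact: transition_oriented.
- exact: volume_neq0.
- exact: jacobian_det0.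
Qed.

(** [chart_at] may jump from point to point, so continuity at x is checked in a single chart kept
    fixed on a neighbourhood of x. *)
Lemma chartwise_continuous (F : M -> R) (Fc : chart_index M -> 'rV[R]_d -> R) :
  (forall i, Ck 0 (D i) (Fc i)) ->
  (forall i x, dom (o := M) i x -> F x = Fc i (chart i x)) -> continuous F.
Proof.
move=> cF FE x; have ix := dom_chart_at x; set i := chart_at x in ix.
have Dx : D i (chart i x) by exists x.
rewrite /prop_for /continuous_at (FE i x ix).
have := continuous_comp (chart_continuous ix) (cF i _ Dx).
apply: cvg_trans; apply: near_eq_cvg.
by apply: filterS (dom_nbhs ix) => z iz; rewrite /= (FE i z iz).
Qed.

Lemma CkM_continuous n f : CkM n f -> continuous f.
Proof.
move=> fS; apply: (@chartwise_continuous f (fun i => f \o cochart i)).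
  move=> i; exact: (Ck_le (leq0n n) (fS i)).
by move=> i x ix; rewrite /= chartK.
Qed.

Lemma Ck0_inner i X Y : (forall k, Ck 0 (D i) (fun y => X i y 0 k)) ->
  (forall k, Ck 0 (D i) (fun y => Y i y 0 k)) -> Ck 0 (D i) (chart_inner i X Y).
Proof.
move=> XS YS; have oD := @chart_open _ _ M i.
have cG l k : Ck 0 (D i) (fun y => metric i y l k) by exact: metric_smooth.
have := Ck_sum oD (fun k => Ck_mul oD (Ck_sum oD (fun l => Ck_mul oD (XS l) (cG l k))) (YS k)).
by apply: (Ck_ext oD) => y Dy; rewrite /chart_inner !mxE; apply: eq_bigr => l _; rewrite !mxE.
Qed.

Lemma inner_continuous X Y : vector_field X -> vector_field Y ->
  (forall i k, Ck 0 (D i) (fun y => X i y 0 k)) ->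
  (forall i k, Ck 0 (D i) (fun y => Y i y 0 k)) -> continuous (inner X Y).
Proof.
move=> fX fY XS YS.
apply: (@chartwise_continuous _ (fun i => chart_inner i X Y)).
  by move=> i; exact: Ck0_inner.
by move=> i x ix; exact: innerE.
Qed.

Lemma inner_grad_continuous f h : CkM 1 f -> CkM 1 h ->
  continuous (inner (grad f) (grad h)).
Proof.
move=> fS hS; apply: (inner_continuous (grad_field fS) (grad_field hS)) => i k.
  exact: (@Ck_grad 0 f i k fS).
exact: (@Ck_grad 0 h i k hS).
Qed.

Lemma laplacian_continuous f : CkM 2 f -> continuous (laplacian f).
Proof.
move=> fS; have f1 : CkM 1 f by move=> i; exact/CkS/fS.
have gS i k : Ck 1 (D i) (fun y => grad f i y 0 k) by exact: Ck_grad.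
apply: (@chartwise_continuous _ (fun i => chart_div i (grad f))).
  move=> i; have oD := @chart_open _ _ M i; apply: (Ck_mul oD).
    by apply: (CkV oD); [exact: volume_neq0|exact: Ck_volume].
  by apply: (Ck_sum oD) => k; exact: (Ck_mul oD (@Ck_volume 1 i) (gS i k)).2.
by move=> i x ix; apply: divergenceE => //; exact: grad_field.
Qed.

Lemma generator_continuous U f : CkM 1 U -> CkM 2 f -> continuous (generator U f).
Proof.
move=> US fS x; have f1 : CkM 1 f by move=> i; exact/CkS/fS.
apply: continuousB; first exact: laplacian_continuous.
exact: inner_grad_continuous.
Qed.

Lemma drift_continuous (b : field_components M) f : C1_vector_field b -> CkM 1 f ->
  continuous (drift b f).
Proof.
move=> [bS fb] f1; apply: inner_continuous => //; first exact: grad_field.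
  by move=> i k; exact/CkS/bS.
by move=> i k; exact: (@Ck_grad 0 f i k f1).
Qed.

Section Algebra.
Implicit Type x : M.

Lemma smoothD_scale (a : R) f h : smooth f -> smooth h -> smooth (a *: f + h).
Proof.
move=> fS hS n i; have oD := @chart_open _ _ M i.
exact: (CkD oD (CkZ oD a (fS n i)) (hS n i)).
Qed.

Lemma smoothM f h : smooth f -> smooth h -> smooth (f \* h).
Proof. by move=> fS hS n i; exact: (Ck_mul (@chart_open _ _ M i) (fS n i) (hS n i)). Qed.

Lemma smooth0 : smooth (0 : M -> R).
Proof. by move=> n i; exact: (Ck_cst (@chart_open _ _ M i) n 0). Qed.

Lemma chart_diff f i y : CkM 1 f -> D i y -> differentiable (f \o cochart (o := M) i) y.
Proof. by move=> fS; exact: (fS i).1. Qed.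

Lemma grad_linear (a : R) f h i y : CkM 1 f -> CkM 1 h -> D i y ->
  grad (a *: f + h) i y = a *: grad f i y + grad h i y.
Proof.
move=> fS hS Dy; rewrite /grad.
have dF := chart_diff fS Dy; have dH := chart_diff hS Dy.
suff -> : (\row_k partial k ((a *: f + h) \o cochart i) y) =
  a *: (\row_k partial k (f \o cochart i) y) + \row_k partial k (h \o cochart i) y.
  by rewrite mulmxDl -scalemxAl.
apply/rowP => k; rewrite !mxE.
rewrite -partialZ// -partialD//.
by apply: differentiableM => //; exact: differentiable_cst.
Qed.

Lemma grad_prod f h i y : CkM 1 f -> CkM 1 h -> D i y ->
  grad (f \* h) i y = f (cochart i y) *: grad h i y + h (cochart i y) *: grad f i y.
Proof.
move=> fS hS Dy; rewrite /grad !scalemxAl -mulmxDl; congr (_ *m _).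
have dF := chart_diff fS Dy; have dH := chart_diff hS Dy.
apply/rowP => k; rewrite !mxE.
have -> : ((f \* h) \o cochart i) = (f \o cochart i) \* (h \o cochart i) by [].
by rewrite partialM//= addrC [_ * h _]mulrC.
Qed.

Lemma laplacian_linear (a : R) f h x : CkM 2 f -> CkM 2 h ->
  laplacian (a *: f + h) x = a * laplacian f x + laplacian h x.
Proof.
move=> fS hS; have f1 : CkM 1 f by move=> i; exact/CkS/fS.
have h1 : CkM 1 h by move=> i; exact/CkS/hS.
rewrite /laplacian /divergence; set i := chart_at x; set y := chart i x.
have Dy : D i y by exists x => //; exact: dom_chart_at.
have oD := @chart_open _ _ M i.
have dv : Ck 1 (D i) _ := @Ck_volume 1 i.
have df k : differentiable (fun z => Num.sqrt (\det (metric i z)) * grad f i z 0 k) y.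
  by apply: differentiableM; [exact: dv.1|exact: (Ck_grad i k fS).1].
have dh k : differentiable (fun z => Num.sqrt (\det (metric i z)) * grad h i z 0 k) y.
  by apply: differentiableM; [exact: dv.1|exact: (Ck_grad i k hS).1].
rewrite mulrCA -mulrDr; congr (_ * _); rewrite mulr_sumr -big_split/=.
apply: eq_bigr => k _; rewrite -partialZ// -partialD//; last first.
  by apply: differentiableM => //; exact: differentiable_cst.
apply: (partial_ext oD) => // z Dz; rewrite /= grad_linear//.
by move: (grad f i z) (grad h i z) => A B; rewrite !mxE; ring.
Qed.

Lemma inner_lin (a : R) X X' X'' Y x : let i := chart_at x in let y := chart i x in
  X i y = a *: X' i y + X'' i y -> inner X Y x = a * inner X' Y x + inner X'' Y x.
Proof.
move=> i y E; rewrite /inner -/i -/y E !mulmxDl -!scalemxAl mxE; congr (_ + _).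
by rewrite mxE.
Qed.

Lemma innerC X Y x : inner X Y x = inner Y X x.
Proof.
rewrite /inner; set i := chart_at x; set y := chart i x.
have Dy : D i y by exists x => //; exact: dom_chart_at.
have <- : (X i y *m metric i y *m (Y i y)^T)^T = Y i y *m metric i y *m (X i y)^T.
  by rewrite !trmx_mul trmxK Defs.metric_sym// mulmxA.
by rewrite [RHS]mxE.
Qed.

Lemma inner_ge0 X x : 0 <= inner X X x.
Proof.
rewrite /inner; set i := chart_at x; set y := chart i x.
have Dy : D i y by exists x => //; exact: dom_chart_at.
have [->|X0] := eqVneq (X i y) 0; first by rewrite !mul0mx mxE.
exact/ltW/metric_pos.
Qed.

Lemma chart_at_image x : D (chart_at x) (chart (chart_at x) x).
Proof. by exists x => //; exact: dom_chart_at. Qed.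

Lemma drift_linear (b : field_components M) (a : R) f h x : CkM 1 f -> CkM 1 h ->
  drift b (a *: f + h) x = a * drift b f x + drift b h x.
Proof.
move=> fS hS; rewrite /drift ![inner b _ _]innerC.
by apply: inner_lin; exact: grad_linear (chart_at_image x).
Qed.

(** The metric of the inner product cancels the inverse metric of one gradient. In this form the
    cross terms of the product rule can be read off. *)
Lemma inner_grad_chart f h x : let i := chart_at x in let y := chart i x in
  inner (grad f) (grad h) x = \sum_k grad f i y 0 k * partial k (h \o cochart i) y.
Proof.
move=> i y; have Dy := chart_at_image x.
rewrite /inner -/i -/y [grad h i y]/grad trmx_mul trmx_inv Defs.metric_sym//.
rewrite mulmxA mulmxK ?metric_unit// mxE; apply: eq_bigr => k _.
by rewrite !mxE.
Qed.

Lemma laplacian_prod f h x : CkM 2 f -> CkM 2 h ->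
  laplacian (f \* h) x =
  f x * laplacian h x + h x * laplacian f x + 2 * inner (grad f) (grad h) x.
Proof.
move=> fS hS; have f1 : CkM 1 f by move=> i; exact/CkS/fS.
have h1 : CkM 1 h by move=> i; exact/CkS/hS.
have -> : 2 * inner (grad f) (grad h) x =
  inner (grad h) (grad f) x + inner (grad f) (grad h) x.
  by rewrite innerC mulr_natl mulr2n.
rewrite !inner_grad_chart /laplacian /divergence; set i := chart_at x; set y := chart i x.
have Dy : D i y by exact: chart_at_image.
have oD := @chart_open _ _ M i; have v0 := volume_neq0 Dy.
have dv : Ck 1 (D i) _ := @Ck_volume 1 i.
have vol k f' : CkM 2 f' ->
    differentiable (fun z => Num.sqrt (\det (metric i z)) * grad f' i z 0 k) y.
  by move=> f'S; apply: differentiableM; [exact: dv.1|exact: (Ck_grad i k f'S).1].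
have xE : x = cochart i y by rewrite chartK//; exact: dom_chart_at.
have alg (v S Sf Sh S1 S2 a1 a2 : R) : v != 0 -> S = a1 * Sh + a2 * Sf + v * (S1 + S2) ->
    v^-1 * S = a1 * (v^-1 * Sh) + a2 * (v^-1 * Sf) + (S1 + S2).
  by move=> vn0 ->; field.
apply: alg => //; rewrite -big_split/= !mulr_sumr -!big_split/=.
apply: eq_bigr => k _.
rewrite (partial_ext oD (G := ((f \o cochart i) \* (fun z => Num.sqrt (\det (metric i z)) * grad h i z 0 k))
  \+ ((h \o cochart i) \* (fun z => Num.sqrt (\det (metric i z)) * grad f i z 0 k))))//; last first.
  move=> z Dz; rewrite /= grad_prod//.
  by move: (grad f i z) (grad h i z) => A B; rewrite !mxE; ring.
have dF := chart_diff f1 Dy; have dH := chart_diff h1 Dy.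
rewrite partialD; try (by apply: differentiableM => //; exact: vol).
rewrite !partialM//; try exact: vol.
rewrite /= -xE; move: (f x) (h x) (grad f i y 0 k) (grad h i y 0 k) => a1 a2 a3 a4.
by move: (partial k _ y) (partial k _ y) (partial k _ y) (partial k _ y) => *; ring.
all: first [exact: dv.1|exact: (Ck_grad i k fS).1|exact: (Ck_grad i k hS).1].
Qed.

(** The first-order part is a derivation, so the cross term is that of the Laplacian alone. *)
Lemma generator_prod U f h x : CkM 2 f -> CkM 2 h ->
  generator U (f \* h) x =
  f x * generator U h x + h x * generator U f x + 2 * inner (grad f) (grad h) x.
Proof.
move=> fS hS; have f1 : CkM 1 f by move=> i; exact/CkS/fS.
have h1 : CkM 1 h by move=> i; exact/CkS/hS.
rewrite /generator laplacian_prod// ![inner (grad U) _ _]innerC.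
have -> : inner (grad (f \* h)) (grad U) x =
  f x * inner (grad h) (grad U) x + h x * inner (grad f) (grad U) x.
  have Dy := chart_at_image x.
  rewrite /inner grad_prod// chartK; last exact: dom_chart_at.
  by rewrite mulmxDl -!scalemxAl mulmxDl -!scalemxAl mxE; congr (_ + _); rewrite mxE.
move: (laplacian f x) (laplacian h x) (inner (grad f) (grad h) x).
by move: (inner (grad f) (grad U) x) (inner (grad h) (grad U) x) => *; ring.
Qed.

End Algebra.
End Manifold.

(** * Continuous functions on the compact manifold as elements of L^2 *)

Section Continuous.
Context (R : realType) (d : nat) (M : orientedRiemannianManifold R d).
Context (compactM : compact [set: M]) (P : probability (borel M) R).

Lemma continuous_borel (F : M -> R) : continuous F ->
  measurable_fun [set: borel M] (F : borel M -> R).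
Proof.
move=> cF; apply: (measurability (RGenOInfty.G (R := R)) (RGenOInfty.measurableE R)).
move=> _ [_ [x ->] <-]; rewrite setTI; apply: sub_sigma_algebra.
by apply: open_comp => //; exact: interval_open.
Qed.

Lemma continuous_l2 (F : M -> R) : continuous F -> l2 P F.
Proof.
move=> cF; have [B [_ HB]] : bounded_set (F @` [set: M]).
  by apply/compact_bounded/continuous_compact => //; exact: continuous_subspaceT.
apply: (@l2_bounded _ _ _ P F (B + 1)); first exact: continuous_borel.
by move=> x; apply: (HB (B + 1)); [rewrite ltrDl|exists x].
Qed.

Lemma L2cvgP u f : (forall n, l2 P (u n)) -> l2 P f ->
  L2cvg P u f <-> cvg_for (l2_ip P) u f.
Proof.
move=> lu lf; rewrite (cvg_forP (l2_ip_psd P) lu lf) /L2cvg.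
have E : (fun n => L2norm P (u n \- f)) = (fun n => (psd_norm (l2_ip P) (u n - f))%:E).
  apply/funext => n; apply: l2_Lnorm.
  exact: (linear_subspaceB (l2_subspace P)).
by rewrite E; split => [/fine_cvgP[]|H] //; apply/fine_cvgP; split => //; exact: nearW.
Qed.

End Continuous.

(** * Spectral consequences, identification of the operators, and the limit *)

Section Main.
Context (R : realType) (d : nat) (M : orientedRiemannianManifold R d).
Context (compactM : compact [set: M]) (U : M -> R) (C1U : CkM 1 U).
Context (P : probability (borel M) R) (ev : nat -> R) (phi : nat -> M -> R).
Context (spectrumA : spectral_basis P U ev phi).
Context (b : field_components M) (C1b : C1_vector_field b).
Local Notation L := (generator U).
Local Notation X := (l2 P).
Local Notation S := (@smooth R d M).
Local Notation ip := (l2_ip P).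
Local Notation E := (dirichlet P).
Let Hip := l2_ip_psd P.
Let sX := l2_subspace P.

Lemma smooth_l2 : S `<=` X.
Proof. by move=> u Su; apply: continuous_l2 => //; exact: (CkM_continuous (Su 0%N)). Qed.

Lemma generator_l2 u : S u -> X (L u).
Proof. by move=> Su; apply: continuous_l2 => //; exact: (generator_continuous C1U (Su 2)). Qed.

Lemma drift_l2 u : S u -> X (drift b u).
Proof. by move=> Su; apply: continuous_l2 => //; exact: (drift_continuous C1b (Su 1)). Qed.

Lemma smooth_subspace : linear_subspace (S : set (M -> R)).
Proof. by split; [exact: smooth0|move=> a f h; exact: smoothD_scale]. Qed.

Lemma inner_grad_l2 u v : S u -> S v -> X (inner (grad u) (grad v)).
Proof.
by move=> Su Sv; apply: continuous_l2 => //; exact: (inner_grad_continuous (Su 1) (Sv 1)).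
Qed.

Lemma dirichletE u v : E u v = ip (inner (grad u) (grad v)) (cst 1).
Proof. by apply: eq_Rintegral => x _; rewrite mulr1. Qed.

Lemma dirichlet_psd : psd_form (S : set (M -> R)) E.
Proof.
split; first exact: smooth_subspace.
- by move=> x y _ _; apply: eq_Rintegral => t _; exact: innerC.
- move=> a x y z Sx Sy Sz; rewrite !dirichletE.
  rewrite -(psd_linear Hip); try exact: inner_grad_l2; last exact: l2_cst.
  congr (ip _ _); apply/funext => t; apply: inner_lin.
  exact: grad_linear (Sx 1) (Sy 1) (chart_at_image t).
- by move=> x _; apply: Rintegral_ge0 => t _; exact: inner_ge0.
Qed.
Let HE := dirichlet_psd.

Lemma phi_l2 n : X (phi n).
Proof. by case: spectrumA => -[lphi _ _] _ _ _; exact: lphi. Qed.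

Lemma phi_ip m n : ip (phi m) (phi n) = (m == n)%:R.
Proof. by case: spectrumA => -[_ H _] _ _ _; exact: H. Qed.

Lemma ev0 : ev 0 = 0. Proof. by case: spectrumA => _ _ _ []. Qed.

Lemma ev_ge0 n : 0 <= ev n.
Proof. by rewrite -ev0; case: spectrumA => _ _ _ [_ _ H _]; exact: H. Qed.

(** This is the adjoint condition in the graph of A for the eigenvector; L is applied only to the
    smooth function u. *)
Lemma ip_phi_generator n u : S u -> ip (phi n) (L u) = - ev n * ip (phi n) u.
Proof.
move=> Su; case: spectrumA => _ /(_ n)[_ _ _ /(_ u Su)] + _ _.
rewrite -[Defs.ip _ _ _]/(ip (phi n) (L u)) => ->.
by rewrite -(psdZl Hip)//; [exact: phi_l2|exact: smooth_l2].
Qed.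

Definition phi_sum (c : nat -> R) m n : M -> R := fun x => \sum_(m <= k < n) c k * phi k x.

Lemma phi_sumP c m n : X (phi_sum c m n) /\
  forall g, X g -> ip g (phi_sum c m n) = \sum_(m <= k < n) c k * ip g (phi k).
Proof.
elim: n => [|n [lS IH]].
  have -> : phi_sum c m 0 = 0 by apply/funext => x; rewrite /phi_sum big_geq.
  split; first exact: sX.1.
  move=> g lg; rewrite big_geq// (psdC Hip) ?(psd0l Hip)//; exact: sX.1.
have [mn|nm] := leqP m n; last first.
  have -> : phi_sum c m n.+1 = 0 by apply/funext => x; rewrite /phi_sum big_geq.
  split; first exact: sX.1.
  move=> g lg; rewrite big_geq// (psdC Hip) ?(psd0l Hip)//; exact: sX.1.
have -> : phi_sum c m n.+1 = c n *: phi n + phi_sum c m n.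
  by apply/funext => x; rewrite /phi_sum big_nat_recr//= addrC.
have lp := linear_subspaceZ (c n) sX (phi_l2 n).
split; first exact: linear_subspaceD.
by move=> g lg; rewrite (psdDr Hip)// (psdZr Hip) ?IH ?big_nat_recr//= 1?addrC//; exact: phi_l2.
Qed.

Lemma phi_expansion f : X f -> cvg_for ip (phi_sum (fun k => ip f (phi k)) 0) f.
Proof.
move=> lf; apply/L2cvgP => //; first by move=> n; case: (phi_sumP (fun k => ip f (phi k)) 0 n).
by case: spectrumA => -[_ _ H] _ _ _; exact: H.
Qed.

(** In the eigenbasis, <L u, v> is the sum of - ev_k <u,phi_k> <v,phi_k>, which is symmetric in u
    and v. *)
Lemma generator_sym f h : S f -> S h -> ip (L f) h = ip f (L h).
Proof.
move=> Sf Sh; have lf := smooth_l2 Sf; have lh := smooth_l2 Sh.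
have lim u v : S u -> S v -> \sum_(0 <= k < n) - ev k * (ip u (phi k) * ip v (phi k))
    @[n --> \oo] --> ip (L u) v.
  move=> Su Sv; have lu := smooth_l2 Su; have lv := smooth_l2 Sv.
  have := cvg_for_ip Hip (fun=> generator_l2 Su)
    (fun n => (phi_sumP (fun k => ip v (phi k)) 0 n).1) (generator_l2 Su) lv
    (cvg_for_cst Hip _) (phi_expansion lv).
  under eq_fun => n do rewrite ((phi_sumP _ 0 n).2 _ (generator_l2 Su)).
  suff -> : (fun n => \sum_(0 <= k < n) - ev k * (ip u (phi k) * ip v (phi k))) =
    (fun n => \sum_(0 <= k < n) ip v (phi k) * ip (L u) (phi k)) by [].
  apply/funext => n; apply: eq_bigr => k _.
  rewrite (psdC Hip (generator_l2 Su) (phi_l2 k)).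
  by rewrite ip_phi_generator// (psdC Hip (phi_l2 k) lu); ring.
rewrite (psdC Hip lf (generator_l2 Sh)).
have lhf := lim h f Sh Sf.
have EE : (fun n => \sum_(0 <= k < n) - ev k * (ip h (phi k) * ip f (phi k))) =
    (fun n => \sum_(0 <= k < n) - ev k * (ip f (phi k) * ip h (phi k))).
  by apply/funext => n; apply: eq_bigr => k _; rewrite [ip h _ * _]mulrC.
by rewrite EE in lhf; exact: (norm_cvg_unique (lim f h Sf Sh) lhf).
Qed.

(** The eigenvector [phi 0] has eigenvalue 0 and is almost everywhere a constant, nonzero because
    its norm is one. *)
Lemma ip1_generator u : S u -> ip (cst 1) (L u) = 0.
Proof.
move=> Su; case: spectrumA => _ _ [c pc] _.
have lc := l2_cst P c; have lL := generator_l2 Su.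
have ipc h : X h -> ip (cst c) h = c * ip (cst 1) h.
  move=> lh; rewrite -(psdZl Hip c (l2_cst P 1) lh); congr (ip _ _).
  by apply/funext => x; apply/esym; exact: mulr1.
have H : c * ip (cst 1) (L u) = 0.
  by rewrite -ipc// -(l2_ip_ae (phi_l2 0) lc lL pc) ip_phi_generator// ev0 oppr0 mul0r.
have c0 : c != 0.
  apply/eqP => c0; have := phi_ip 0 0.
  rewrite (l2_ip_ae (phi_l2 0) lc (phi_l2 0) pc) ipc; last exact: phi_l2.
  by rewrite c0 mul0r eqxx => /eqP; rewrite eq_sym oner_eq0.
by move/eqP: H; rewrite mulf_eq0 (negPf c0) => /eqP.
Qed.

(* Green's identity, without the divergence theorem: integrate the product    *)
(* rule for [L (u v)], the integral of which is [<1, L (u v)> = 0].           *)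
Lemma green u v : S u -> S v -> E u v = - ip (L u) v.
Proof.
move=> Su Sv; have Suv := smoothM Su Sv.
have cX (h k : M -> R) : continuous h -> continuous k -> X (h \* k).
  by move=> ch ck; apply: continuous_l2 => // x; exact: (continuousM (ch x) (ck x)).
have lS w w' : S w -> S w' -> X (w \* L w').
  move=> Sw Sw'; apply: cX; first exact: (CkM_continuous (Sw 0)).
  exact: (generator_continuous C1U (Sw' 2)).
have l1 := lS _ _ Su Sv; have l2' := lS _ _ Sv Su; have l3 := inner_grad_l2 Su Sv.
have l23 : X (2 *: inner (grad u) (grad v) + v \* L u) by exact: sX.2.
have lc := l2_cst P 1.
have ipM w w' : ip (cst 1) (w \* w') = ip w w'.
  by apply: eq_Rintegral => x _; rewrite mul1r.
have H : ip (cst 1) (L (u \* v)) = ip u (L v) + ip v (L u) + 2 * E u v.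
  have -> : L (u \* v) = u \* L v + (2 *: inner (grad u) (grad v) + v \* L u).
    apply/funext => x; rewrite (generator_prod U x (Su 2) (Sv 2)) -addrA; congr (_ + _).
    by rewrite addrC.
  rewrite (psdDr Hip)// (psdDr Hip)//; last exact: linear_subspaceZ.
  rewrite (psdZr Hip)// !ipM dirichletE (psdC Hip lc l3).
  by rewrite -addrA; congr (_ + _); rewrite addrC.
move: H; rewrite ip1_generator// -generator_sym// (psdC Hip (smooth_l2 Sv) (generator_l2 Su)).
move: (ip _ _) (E u v) => x y; lra.
Qed.

Local Notation F := (form_dom X S ip E).
Local Notation Ex := (form_ext S ip E).
Let HF := form_ext_psd Hip HE smooth_l2 generator_l2 green.
Let sF := psd_subspace HF.

Lemma H1_approxP f u : X f -> H1_approx P f u <-> core_approx S ip E f u.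
Proof.
move=> lf; rewrite /H1_approx /form_approx.
split=> -[Su uf cu]; have H := L2cvgP (fun n => smooth_l2 (Su n)) lf; split=> //.
  exact: (H.1 uf).
exact: (H.2 uf).
Qed.

Lemma H1_ipE f h : X f -> X h -> H1_ip P f h = Ex f h.
Proof.
move=> lf lh; congr (xget _ _); apply/seteqP; split=> c [u [v [au av Hc]]].
  exists u, v; split; last exact: Hc.
    exact: (H1_approxP u lf).1 au.
  exact: (H1_approxP v lh).1 av.
exists u, v; split; last exact: Hc.
  exact: (H1_approxP u lf).2 au.
exact: (H1_approxP v lh).2 av.
Qed.

(** By Green's identity, the form - <L h, h> of the Friedrichs construction is the Dirichlet form,
    so both have the same approximating sequences. *)
Lemma A_graphP f w : A_graph P U f w <->
  [/\ F f, X w & forall h, S h -> ip f (L h) = ip w h].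
Proof.
have Sd (u : nat -> M -> R) : (forall n, S (u n)) -> forall m n, S (u m \- u n).
  by move=> Su m n; exact: (linear_subspaceB smooth_subspace (Su m) (Su n)).
have approxE u : X f -> form_approx P S (fun h => - ip (L h) h) f u <->
    core_approx S ip E f u.
  move=> lf; split=> -[Su uf cu]; have H := L2cvgP (fun n => smooth_l2 (Su n)) lf; split=> //.
  - exact: (H.1 uf).
  - move=> eps /cu[N HN]; exists N => m n Nm Nn.
    by rewrite green; [exact: HN|exact: (Sd _ Su m n)|exact: (Sd _ Su m n)].
  - exact: (H.2 uf).
  - move=> eps /cu[N HN]; exists N => m n Nm Nn.
    by rewrite -green; [exact: HN|exact: (Sd _ Su m n)|exact: (Sd _ Su m n)].
split=> [[lf lw [u au] H]|[[lf [u au]] lw H]].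
  by split=> //; split=> //; exists u; exact/approxE.
by split=> //; exists u; exact/approxE.
Qed.

(** The identity holds for smooth test functions by definition of the graph, and extends to the form
    domain by density in energy. *)
Lemma A_form f w h : A_graph P U f w -> F h -> Ex f h = - ip w h.
Proof.
move=> /A_graphP[Ff lw H] Fh; have [lh [v av]] := Fh; have [Sv vh _] := av.
have Fv n : F (v n) by exact/(form_dom_sub Hip HE smooth_l2)/Sv.
have l1 := cvg_for_ip HF (fun=> Ff) Fv Ff Fh (cvg_for_cst HF f)
  (form_ext_approx Hip HE smooth_l2 generator_l2 green lh av).
apply: (norm_cvg_unique l1).
have -> : (fun n => Ex f (v n)) = (fun n => - ip w (v n)).
  apply/funext => n.
  by rewrite (form_ext_gen Hip HE smooth_l2 generator_l2 green Ff)// H.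
apply: cvgN; apply: (cvg_for_ip Hip (fun=> lw)) => //; first by move=> n; exact/smooth_l2/Sv.
exact: (cvg_for_cst Hip).
Qed.

Lemma phi_form n h : F h -> Ex (phi n) h = ev n * ip (phi n) h.
Proof.
move=> Fh; case: spectrumA => _ /(_ n) A _ _; rewrite (A_form A Fh).
have -> : (fun x => - ev n * phi n x) = - ev n *: phi n by [].
by rewrite (psdZl Hip) ?mulNr ?opprK//; [exact: phi_l2|case: Fh].
Qed.

Lemma phi_dom n : F (phi n).
Proof. by case: spectrumA => _ /(_ n)/A_graphP[]. Qed.

(** Subtract from f its components along the first n eigenvectors, which are orthogonal for the
    energy too; what remains has nonnegative energy, equal to the difference of the two sides. *)
Lemma bessel f n : F f -> \sum_(0 <= k < n) ip f (phi k) ^+ 2 * ev k <= Ex f f.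
Proof.
move=> Ff; have [lf _] := Ff.
suff [g [Fg gphi gE]] : exists g, [/\ F g,
    forall m, (n <= m)%N -> ip (phi m) g = ip f (phi m) &
    Ex g g = Ex f f - \sum_(0 <= k < n) ip f (phi k) ^+ 2 * ev k].
  by have := psd_ge0 HF Fg; rewrite gE subr_ge0.
elim: n => [|n [g [Fg gphi gE]]].
  exists f; split=> //; last by rewrite big_geq// subr0.
  by move=> m _; rewrite (psdC Hip)//; exact: phi_l2.
pose a := ip f (phi n); have Fp := phi_dom n.
have Fap : F (a *: phi n) by exact: linear_subspaceZ.
have [lg _] := Fg; have lp := phi_l2; have lap : X (a *: phi n) by case: Fap.
exists (g - a *: phi n); split.
- exact: linear_subspaceB.
- move=> m nm; rewrite (psdBr Hip)// (psdZr Hip)// phi_ip gphi; last exact: ltnW.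
  by rewrite gtn_eqF// mulr0 subr0.
- rewrite (psdB_sqr HF)// (psdZr HF)// (psdC HF Fg Fp) phi_form// gphi//.
  rewrite (psdZl HF)// (psdZr HF)// phi_form// phi_ip eqxx gE big_nat_recr//= -/a.
  by move: (\sum_(_ <= _ < _) _) (Ex f f) => x y; ring.
Qed.

Lemma sobolev_mean m f : Sobolev P ev phi m f -> X f /\ ip f (phi 0) = 0.
Proof.
move=> [lf [a [af _]]]; split=> //; have lS n := (phi_sumP a 1 n).1.
have {}af := (L2cvgP lS lf).1 af.
have H := cvg_for_ip Hip lS (fun=> phi_l2 0) lf (phi_l2 0) af (cvg_for_cst Hip _).
apply: (norm_cvg_unique H).
have -> : (fun n => ip (phi_sum a 1 n) (phi 0)) = cst 0; last exact: cvg_cst.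
apply/funext => n; rewrite (psdC Hip (lS n) (phi_l2 0)).
rewrite (phi_sumP a 1 n).2; last exact: phi_l2.
rewrite big_nat_cond big1// => k /andP[/andP[k1 _] _].
by rewrite phi_ip ltn_eqF// mulr0.
Qed.

(** The Fourier coefficients of f serve as the sequence; [bessel] bounds their weighted sum by the
    energy of f. *)
Lemma mean_sobolev f : F f -> ip f (phi 0) = 0 -> Sobolev P ev phi 1 f.
Proof.
move=> Ff f0; have [lf _] := Ff; split=> //; exists (fun k => ip f (phi k)); split.
  apply/L2cvgP => //; first by move=> n; exact: (phi_sumP _ 1 n).1.
  have H := phi_expansion lf; pose c k := ip f (phi k).
  have Ec : phi_sum c 0 = phi_sum c 1.
    apply/funext => -[|n]; apply/funext => x; first by rewrite /phi_sum !big_geq.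
    by rewrite /phi_sum big_ltn// {1}/c f0 mul0r add0r.
  by rewrite -/c Ec in H; exact: H.
apply: (@le_lt_trans _ _ (Ex f f)%:E); last exact: ltry.
have nn k : (0 <= (`|ip f (phi k)| ^+ 2 * ev k ^+ 1)%:E)%E.
  by rewrite lee_fin mulr_ge0 ?sqr_ge0// expr1 ev_ge0.
apply: lime_le; first by apply: is_cvg_nneseries => k _ _; exact: nn.
apply: nearW => n; rewrite sumEFin lee_fin; apply: le_trans (bessel n Ff).
case: n => [|n]; first by rewrite !big_geq.
(* Bessel's sum starts at 0 and the Sobolev sum at 1; the extra term vanishes because ev 0 = 0. *)
rewrite [leRHS]big_ltn// ev0 mulr0 add0r; apply: ler_sum => k _.
by rewrite expr1 real_normK ?num_real.
Qed.

Local Notation K := (closed_core X S ip E (drift b) (phi 0)).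

(** Membership in H^1 amounts to lying in the form domain and being orthogonal to [phi 0], by
    [sobolev_mean] and [mean_sobolev]. *)
Lemma KerBP f : KerB P ev phi b f <-> K f.
Proof.
have l0 : X (cst 0) by exact: l2_cst.
have TX (u : nat -> M -> R) (Su : forall n, S (u n)) n : X ((drift b \o u) n) by exact: drift_l2.
split=> [[/sobolev_mean[lf f0] _ [u au du]]|[lf f0 [u au du]]].
  have au' := (H1_approxP u lf).1 au; have [Su _ _] := au'.
  split=> //; exists u => //; exact: (L2cvgP (TX u Su) l0).1 du.
have [Su _ _] := au.
split; first by apply: mean_sobolev => //; split=> //; exists u.
  split=> //; exists (fun=> 0); split.
    have -> : (fun (n : nat) (x : M) => \sum_(1 <= k < n) 0 * phi k x) = (fun=> cst 0).
      by apply/funext => n; apply/funext => x; rewrite big1// => k _; rewrite mul0r.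
    by apply/L2cvgP => //; exact: (cvg_for_cst Hip).
  by rewrite eseries0 ?ltry// => k _ _; rewrite normr0 expr0n mul0r.
exists u; first exact: ((H1_approxP u lf).2 au).
exact: (L2cvgP (TX u Su) l0).2 du.
Qed.

Lemma drift_lin (a : R) u v : S u -> S v ->
  drift b (a *: u + v) = a *: drift b u + drift b v.
Proof. by move=> Su Sv; apply/funext => x; exact: drift_linear. Qed.

(** A solution exists, so [xget] does not return its default: the weak solution f of
    [form_resolvent] belongs to the graph of A with image lam f + g. *)
Lemma A_resolventP lam g : 0 < lam -> X g ->
  exists2 w, A_graph P U (A_resolvent P U lam g) w &
    {ae P, forall x, w x - lam * A_resolvent P U lam g x = g x}.
Proof.
move=> l0 lg; rewrite /A_resolvent; set Q := [set f | _].
suff : Q (xget (cst 0) Q) by [].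
apply: xgetPex.
have [f Ff Hf] := form_resolvent Hip (@l2_complete _ _ _ P) HE smooth_l2
  generator_l2 green l0 lg.
have [lf _] := Ff; exists f, (lam *: f + g).
  apply/A_graphP; split=> //; first exact: sX.2.
  move=> h Sh; have := Hf h (form_dom_sub Hip HE smooth_l2 Sh).
  rewrite /form_shift (form_ext_gen Hip HE smooth_l2 generator_l2 green)//.
  rewrite (psd_linear Hip)//; last exact: smooth_l2.
  by move: (ip f _) (ip f h) (ip g h) => x y z; lra.
apply: aeW => x; change (lam * f x + g x - lam * f x = g x); ring.
Qed.

Lemma A_resolvent_form lam g : 0 < lam -> X g ->
  F (A_resolvent P U lam g) /\ forall eta, F eta ->
  form_shift S ip E lam (A_resolvent P U lam g) eta = - ip g eta.
Proof.
move=> l0 lg; have [w Aw wg] := A_resolventP l0 lg; set f := A_resolvent _ _ _ _ in Aw wg *.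
have [Ff lw _] := (A_graphP f w).1 Aw; have [lf _] := Ff; split=> // eta Fe.
have [le _] := Fe; rewrite /form_shift (A_form Aw Fe).
have llf : X (lam *: f) by exact: linear_subspaceZ.
have lwf : X (w - lam *: f) by exact: linear_subspaceB.
rewrite -(l2_ip_ae lwf lg le wg) (psdBl Hip)// (psdZl Hip)//.
by rewrite opprB addrC.
Qed.

Lemma ip1E lam f h : X f -> X h -> ip1 P lam f h = form_shift S ip E lam f h.
Proof. by move=> lf lh; rewrite /ip1 H1_ipE. Qed.

(** The projection exists by [closed_core_projection], so [KerB_proj] has its defining property and
    the abstract estimate applies. *)
Lemma Rstar_estimate lam g f : 0 < lam -> X g -> K f ->
  X (Rstar P ev phi b U lam g) /\
  let e := lam *: Rstar P ev phi b U lam g - f in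
  ip e e <= ip (g - f) (g - f) + Ex f f / (2 * lam).
Proof.
move=> l0 lg Kf; have [Fpsi Hpsi] := A_resolvent_form l0 lg.
set psi := A_resolvent P U lam g in Fpsi Hpsi.
have KF := @closed_core_dom _ _ X S ip E (drift b) (phi 0).
have sK := closed_core_subspace Hip HE smooth_l2 drift_l2 drift_lin (phi_l2 0).
have [p0 Kp0 Hp0] := closed_core_projection Hip (@l2_complete _ _ _ P) HE smooth_l2
  generator_l2 green drift_l2 drift_lin (phi_l2 0) l0 Fpsi.
have lK h : K h -> X h by case.
have lpsi : X psi by case: Fpsi.
have [Kp Hp] : KerB P ev phi b (KerB_proj P ev phi b lam psi) /\
    forall eta, KerB P ev phi b eta ->
      ip1 P lam (psi \- KerB_proj P ev phi b lam psi) eta = 0.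
  rewrite /KerB_proj; set Q := [set p | _]; suff : Q (xget (cst 0) Q) by [].
  apply: xgetPex; exists p0; split; first exact/KerBP.
  move=> eta /KerBP Ke; rewrite ip1E; first exact: Hp0.
    exact: (linear_subspaceB sX lpsi (lK _ Kp0)).
  exact: lK.
move: Kp Hp => /KerBP Kp Hp; have lp := lK _ Kp; split.
  exact: (linear_subspaceN sX lp).
apply: (resolvent_estimate Hip HE smooth_l2 generator_l2 green l0 sK KF Fpsi lg Kp Kf Hpsi) => //.
move=> eta Ke; rewrite -(Hp eta); last exact/KerBP.
rewrite ip1E//; last exact: lK.
exact: (linear_subspaceB sX lpsi lp).
Qed.

Lemma Rstar_cvg g : KerB_closure P ev phi b g ->
  L2norm P (fun x => lam * Rstar P ev phi b U lam g x - g x)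
    @[lam --> +oo] --> 0%E.
Proof.
move=> [Sg cg]; have [lg _] := sobolev_mean Sg.
have normE lam : 0 < lam -> L2norm P (fun x => lam * Rstar P ev phi b U lam g x - g x)
    = (psd_norm ip (lam *: Rstar P ev phi b U lam g - g))%:E.
  (* The estimate is used here with f = 0, only to learn that [Rstar] g is square integrable, so
     that its extended norm is a real number. *)
  move=> l0; have /KerBP K0 : KerB P ev phi b (cst 0).
    apply/KerBP; exact: (closed_core_subspace Hip HE smooth_l2 drift_l2 drift_lin (phi_l2 0)).1.
  have [lR _] := Rstar_estimate l0 lg K0.
  have lr := linear_subspaceB sX (linear_subspaceZ lam sX lR) lg.
  transitivity (L2norm P (lam *: Rstar P ev phi b U lam g - g)); first by [].
  exact: (l2_Lnorm lr).
apply/fine_cvgP; split.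
  by near=> lam; rewrite normE.
apply/cvgrPdist_lt => eps e0; have e4 : 0 < eps / 4 by rewrite divr_gt0.
(* Both terms of the estimate will be below (eps / 4)^2, so |lam r - f| < eps / 2; adding |f - g| <
   eps / 4 stays below eps. *)
have [f /KerBP Kf fgL] := cg _ e4; have [lf _ _] := Kf.
have fg : psd_norm ip (f - g) < eps / 4.
  by rewrite -lte_fin -(l2_Lnorm (linear_subspaceB sX lf lg)).
near=> lam; have l0 : 0 < lam by near: lam; exact: nbhs_pinfty_gt.
rewrite /comp normE//= sub0r normrN ger0_norm ?psd_norm_ge0//.
have [lR] := Rstar_estimate l0 lg Kf.
set r := Rstar _ _ _ _ _ _ _ in lR *; move=> /= est.
have lr : X (lam *: r) by exact: linear_subspaceZ.
have le : X (lam *: r - f) by exact: linear_subspaceB.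
have lgf : X (g - f) by exact: linear_subspaceB.
apply: le_lt_trans (psd_norm_sub Hip lr lf lg) _.
suff : psd_norm ip (lam *: r - f) < eps / 2 by lra.
rewrite -(@ltr_pXn2r _ 2)// ?nnegrE ?psd_norm_ge0 ?divr_ge0 ?(ltW e0)//.
rewrite (psd_normE Hip le); apply: le_lt_trans est _.
rewrite -(psd_normE Hip lgf) (psd_normBC Hip lg lf).
have h1 : psd_norm ip (f - g) ^+ 2 < (eps / 4) ^+ 2.
  by rewrite ltr_pXn2r// ?nnegrE ?psd_norm_ge0 ?(ltW e4).
have h2 : Ex f f / (2 * lam) < (eps / 4) ^+ 2.
  rewrite ltr_pdivrMr ?mulr_gt0// -ltr_pdivrMl ?exprn_gt0//.
  rewrite -ltr_pdivrMl//; near: lam; apply: nbhs_pinfty_gt; exact: num_real.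
have : (eps / 4) ^+ 2 + (eps / 4) ^+ 2 <= (eps / 2) ^+ 2.
  by rewrite !expr2; nra.
move: h1 h2; move: (psd_norm _ _ ^+ 2) (Ex f f / _) => x y; lra.
Unshelve. all: by end_near. Qed.

End Main.

Theorem proposition4 (R : realType) (d : nat)
    (M : orientedRiemannianManifold R d)
    (compactM : compact [set: M])
    (vol : {measure set (borel M) -> \bar R})
    (volM : is_riemannian_volume vol)
    (U : M -> R) (C1U : CkM 1 U)
    (P : probability (borel M) R)
    (PE : forall A : set (borel M), measurable A ->
      P A = (\int[vol]_(x in A) (expR (- U x))%:E)%E)
    (ev : nat -> R) (phi : nat -> M -> R)
    (spectrumA : spectral_basis P U ev phi)
    (b : field_components M) (C1b : C1_vector_field b)
    (div_free : forall x : M,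
      divergence (fun i y => expR (- U (cochart i y)) *: b i y) x = 0)
    (H1_dom : forall f : M -> R, Sobolev P ev phi 1 f -> drift_dom P b f)
    (g : M -> R) (gK : KerB_closure P ev phi b g) :
  L2norm P (fun x => lam * Rstar P ev phi b U lam g x - g x)
    @[lam --> +oo] --> 0%E.
Proof. exact: (Rstar_cvg compactM C1U spectrumA C1b gK). Qed.
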